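(* Let $H$ be a finitely generated free-abelian group, $\mathbb{K}$ a skew-field, and $\mathbb{K}H$ a twisted group ring of $H$ with coefficients in $\mathbb{K}$. Let $A$ be a square matrix over $\mathbb{K}H$. Then its Newton polytope $P(A)\in\mathcal{P}(H)\sqcup\{\emptyset\}$ is empty or a single polytope.
   Context: Twisted group ring: for a ring $R$ and a group $G$, let $\varphi\colon G\to\mathrm{Aut}(R)$ and $\mu\colon G\times G\to R^\times$ satisfy $\varphi(g)\circ\varphi(g')=c(\mu(g,g'))\circ\varphi(gg')$ and $\mu(g,g')\mu(gg',g'')=\varphi(g)(\mu(g',g''))\,\mu(g,g'g'')$, where $c(r)$ is left conjugation by $r$. The twisted group ring $RG$ is the abelian group of finitely supported functions $G\to R$, written as sums $\sum x(g)g$, with multiplication $rg\cdot r'g'=r\,\varphi(g)(r')\,\mu(g,g')\,gg'$ extended linearly. The ring $\mathbb{K}H$ has no zero-divisors and satisfies the Ore condition; $\mathcal{D}$ denotes its Ore localisation, a skew-field containing $\mathbb{K}H$ whose elements are fractions $pq^{-1}$ with $p,q\in\mathbb{K}H$, $q\neq0$. Polytopes: a polytope in $H_1(H;\mathbb{R})=H\otimes\mathbb{R}$ is a compact intersection of finitely many affine halfspaces; it is integral if its vertices lie in $H$. $\mathcal{P}(H)$ is the Grothendieck group of the (cancellative abelian) monoid of non-empty integral polytopes under Minkowski sum; its elements are formal differences $P-Q$. An element is a single polytope if it can be represented as $P-Q$ with $Q$ a singleton. Newton polytopes: for $0\ne p\in\mathbb{K}H$, $P(p)$ is the convex hull in $H_1(H;\mathbb{R})$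 of the support $\{h\mid p(h)\neq0\}$. Setting $P(pq^{-1})=P(p)-P(q)$ gives a homomorphism $\mathcal{D}^\times\to\mathcal{P}(H)$, which factors through $\mathcal{D}^\times/[\mathcal{D}^\times,\mathcal{D}^\times]$; put $P(0)=\emptyset$. For a square matrix $A$ over $\mathbb{K}H$, $P(A)=P(\det (A\otimes\mathcal{D}))$, where $\det$ is the Dieudonné determinant with values in $\mathcal{D}^\times/[\mathcal{D}^\times,\mathcal{D}^\times]\sqcup\{0\}$ and $A\otimes\mathcal{D}$ is $A$ viewed as a matrix over $\mathcal{D}$. *)

(* Defs.v *)
From HB Require Import structures.
From mathcomp Require Import all_boot all_order all_algebra finmap.
From mathcomp Require Import monalg.
From mathcomp Require Import all_classical all_reals interval_inference topology normedtype convex.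
From mathcomp Require Import ring lra.

Set Implicit Arguments.
Unset Strict Implicit.
Unset Printing Implicit Defensive.

Import Order.TTheory GRing.Theory Num.Theory.
Import numFieldNormedType.Exports.

Local Open Scope ring_scope.

(* phi = tw_act and mu = tw_coc; no normalisation of mu is required, so that the
   unit of the twisted group ring is mu(0,0)^-1 * 0, see tw_one. The group G is
   written additively. *)
Record twisting (R : unitRingType) (G : zmodType) := Twisting {
  tw_act : G -> {rmorphism R -> R};
  tw_coc : G -> G -> R;
  tw_act_bij : forall g, bijective (tw_act g);
  tw_coc_unit : forall g h, tw_coc g h \is a GRing.unit;
  tw_act_comp : forall g h r,
    tw_act g (tw_act h r) = tw_coc g h * tw_act (g + h) r * (tw_coc g h)^-1;
  tw_cocycle : forall g h k,
    tw_coc g h * tw_coc (g + h) k = tw_act g (tw_coc h k) * tw_coc g (h + k)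
}.

(* As an abelian group: finitely supported functions G -> R. The product is
   tw_mul below. *)
Definition twgring (R : unitRingType) (G : zmodType) (t : twisting R G) : Type :=
  {malg R[G]}.

HB.instance Definition _ R G t := GRing.Zmodule.on (@twgring R G t).

Section TwistedGroupRing.
Local Open Scope fset_scope.
Local Open Scope ring_scope.
Variables (R : unitRingType) (G : zmodType) (t : twisting R G).
Local Notation phi := (tw_act t).
Local Notation mu := (tw_coc t).
Local Notation S := (twgring t).
Implicit Types (x y z : S) (g h k : G) (r : R).

Definition tw_mul x y : S :=
  \sum_(g <- msupp x) \sum_(h <- msupp y)
     << x@_g * phi g y@_h * mu g h *g g + h >>.

Definition tw_one : S := << (mu 0 0)^-1 *g 0 >>.

Lemma tw_mulw (d1 d2 : {fset G}) x y :
  msupp x `<=` d1 -> msupp y `<=` d2 ->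
  tw_mul x y = \sum_(g <- d1) \sum_(h <- d2)
     << x@_g * phi g y@_h * mu g h *g g + h >>.
Proof.
move=> le1 le2; rewrite /tw_mul (big_fset_incl _ le1) /=; last first.
  move=> g _ /mcoeff_outdom ->; rewrite big1 // => h _.
  by rewrite !mul0r monalgU0.
apply: eq_bigr => g _; rewrite (big_fset_incl _ le2) //= => h _.
by move=> /mcoeff_outdom ->; rewrite raddf0 mulr0 mul0r monalgU0.
Qed.

Lemma tw_mulDl : left_distributive tw_mul +%R.
Proof.
move=> x y z; set d := msupp x `|` msupp y.
rewrite (@tw_mulw d (msupp z)) ?msuppD_le //.
rewrite (@tw_mulw d (msupp z) x) ?fsubsetUl // (@tw_mulw d (msupp z) y) ?fsubsetUr //.
rewrite -big_split; apply: eq_bigr => g _ /=.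
by rewrite -big_split; apply: eq_bigr => h _ /=; rewrite mcoeffD !mulrDl monalgUD.
Qed.

Lemma tw_mulDr : right_distributive tw_mul +%R.
Proof.
move=> z x y; set d := msupp x `|` msupp y.
rewrite (@tw_mulw (msupp z) d) ?msuppD_le //.
rewrite (@tw_mulw (msupp z) d z x) ?fsubsetUl //.
rewrite (@tw_mulw (msupp z) d z y) ?fsubsetUr //.
rewrite -big_split; apply: eq_bigr => g _ /=; rewrite -big_split.
apply: eq_bigr => h _ /=.
by rewrite mcoeffD raddfD mulrDr mulrDl monalgUD.
Qed.

Lemma tw_mul0r : left_zero 0 tw_mul.
Proof. by move=> x; rewrite /tw_mul msupp0 big_seq_fset0. Qed.

Lemma tw_mulr0 : right_zero 0 tw_mul.
Proof.
by move=> x; rewrite /tw_mul big1 // => g _; rewrite msupp0 big_seq_fset0.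
Qed.

Lemma tw_mulUU (r s : R) g h :
  tw_mul << r *g g >> << s *g h >> = << r * phi g s * mu g h *g g + h >>.
Proof.
by rewrite (@tw_mulw [fset g] [fset h]) ?msuppU_le // !big_seq_fset1 !mcoeffUU.
Qed.

Lemma tw_mul_suml (I : Type) (s : seq I) (F : I -> S) y :
  tw_mul (\sum_(i <- s) F i) y = \sum_(i <- s) tw_mul (F i) y.
Proof.
exact: (big_morph (tw_mul^~ y) (fun a b => tw_mulDl a b y) (tw_mul0r y)).
Qed.

Lemma tw_mul_sumr (I : Type) (s : seq I) (F : I -> S) y :
  tw_mul y (\sum_(i <- s) F i) = \sum_(i <- s) tw_mul y (F i).
Proof. exact: (big_morph (tw_mul y) (tw_mulDr y) (tw_mulr0 y)). Qed.

Lemma tw_expand x : x = \sum_(g <- msupp x) (<< x@_g *g g >> : S).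
Proof. exact: monalgE. Qed.

Lemma tw_mulA : associative tw_mul.
Proof.
move=> x y z; rewrite (tw_expand x) (tw_expand y) (tw_expand z).
pose U (x : S) g : S := << x@_g *g g >>.
rewrite -[\sum_(g <- msupp x) _]/(\sum_(g <- msupp x) U x g).
rewrite -[\sum_(g <- msupp y) _]/(\sum_(g <- msupp y) U y g).
rewrite -[\sum_(g <- msupp z) _]/(\sum_(g <- msupp z) U z g).
move: (msupp x : seq G) (msupp y : seq G) (msupp z : seq G) => dx dy dz.
rewrite (tw_mul_suml dx (U x) (tw_mul (\sum_(h <- dy) U y h) (\sum_(k <- dz) U z k))).
rewrite (tw_mul_suml dx (U x) (\sum_(h <- dy) U y h)).
rewrite (tw_mul_suml dx (fun g => tw_mul (U x g) _)).
apply: eq_bigr => g _.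
rewrite (tw_mul_suml dy (U y)) (tw_mul_sumr dy (fun h => tw_mul (U y h) _)).
rewrite (tw_mul_sumr dy (U y)) (tw_mul_suml dy (fun h => tw_mul _ (U y h))).
apply: eq_bigr => h _; rewrite !(tw_mul_sumr dz (U z)).
rewrite (tw_mul_sumr dz (fun k => tw_mul _ (U z k))).
apply: eq_bigr => k _; rewrite /U.
rewrite !tw_mulUU addrA; congr (<< _ *g _ >>).
rewrite !rmorphM /= tw_act_comp -!mulrA; congr (_ * (_ * _)).
by rewrite -tw_cocycle !mulrA mulrVK ?tw_coc_unit.
Qed.

Lemma tw_act0 r : phi 0 r = mu 0 0 * r * (mu 0 0)^-1.
Proof.
have [f _ fK] := tw_act_bij t 0.
by rewrite -{1}(fK r) tw_act_comp addr0 fK.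
Qed.

Lemma tw_coc0l g : mu 0 g = mu 0 0.
Proof.
have /= := tw_cocycle t 0 0 g; rewrite !add0r tw_act0 -!mulrA.
move/(mulrI (tw_coc_unit t 0 0)); rewrite -{1}[mu 0 g]mulr1.
move/(mulrI (tw_coc_unit t 0 g)) => e.
by apply: (mulrI (x := (mu 0 0)^-1)); rewrite ?unitrV -?e ?mulVr ?tw_coc_unit.
Qed.

Lemma tw_coc0r g : mu g 0 = phi g (mu 0 0).
Proof.
have /= := tw_cocycle t g 0 0; rewrite !addr0.
by move/(mulIr (tw_coc_unit t g 0)).
Qed.

Lemma tw_mul1r : left_id tw_one tw_mul.
Proof.
move=> x; rewrite {2}(tw_expand x) {1}(tw_expand x) tw_mul_sumr.
apply: eq_bigr => g _; rewrite tw_mulUU add0r tw_act0 tw_coc0l.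
by rewrite !mulrA mulVr ?tw_coc_unit // mul1r mulrVK ?tw_coc_unit.
Qed.

Lemma tw_mulr1 : right_id tw_one tw_mul.
Proof.
move=> x; rewrite {2}(tw_expand x) {1}(tw_expand x) tw_mul_suml.
apply: eq_bigr => g _; rewrite tw_mulUU addr0 (tw_coc0r g) -mulrA -(rmorphM (phi g)).
by rewrite mulVr ?tw_coc_unit // rmorph1 mulr1.
Qed.

Lemma tw_one_neq0 : tw_one != 0.
Proof.
rewrite monalgU_eq0; apply: contraTneq (tw_coc_unit t 0 0) => mu0.
by rewrite -unitrV mu0 unitr0.
Qed.

HB.instance Definition _ := GRing.Zmodule_isNzRing.Build S
  tw_mulA tw_mul1r tw_mulr1 tw_mulDl tw_mulDr tw_one_neq0.

End TwistedGroupRing.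

Local Open Scope classical_set_scope.
Local Open Scope quotient_scope.

Section Polytopes.
Variables (R : realType) (n : nat).
Local Notation V := 'rV[R]_n.
Implicit Types (a : 'cV[R]_n) (x y : V) (P Q : set V).

(* 'rV[R]_n stands for H_1(H;R) = H (x) R in the coordinates given by a basis of
   H, so that H itself is the lattice of integer vectors; column vectors are
   linear functionals. *)
Definition pairing a x : R := (x *m a) 0 0.

Definition halfspace a (b : R) : set V := [set x | pairing a x <= b].

Definition polytope P :=
  compact P /\
  exists (I : finType) (a : I -> 'cV[R]_n) (b : I -> R),
    (forall i, a i != 0) /\ P = \bigcap_(i in setT) halfspace (a i) (b i).

(* The face of P on which the functional a is minimal; a vertex is a face
   consisting of one point. *)
Definition face a P : set V := [set x | P x /\ forall y, P y -> pairing a x <= pairing a y].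

Definition vertex P x := exists a, face a P = [set x].

Definition lattice : set V := [set map_mx intr z | z in [set: 'rV[int]_n]].

Definition integral_vertices P := vertex P `<=` lattice.

Record ipolytope := IPolytope {
  ipoly :> set V;
  ipoly_poly : polytope ipoly;
  ipoly_nonempty : ipoly !=set0;
  ipoly_integral : integral_vertices ipoly
}.

Definition convex_hull P : set V := smallest (@convex_set R V) P.

Definition minkowski_sum P Q : set V := [set x + y | x in P & y in Q].

Lemma pairingDr a x y : pairing a (x + y) = pairing a x + pairing a y.
Proof. by rewrite /pairing mulmxDl mxE. Qed.
Lemma pairingBr a x y : pairing a (x - y) = pairing a x - pairing a y.
Proof. by rewrite /pairing mulmxBl !mxE. Qed.
Lemma pairingZr a (c : R) x : pairing a (c *: x) = c * pairing a x.
Proof. by rewrite /pairing -scalemxAl mxE. Qed.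
Lemma pairingDl a a' x : pairing (a + a') x = pairing a x + pairing a' x.
Proof. by rewrite /pairing mulmxDr mxE. Qed.
Lemma pairingZl a (c : R) x : pairing (c *: a) x = c * pairing a x.
Proof. by rewrite /pairing -scalemxAr mxE. Qed.
Lemma pairingNl a x : pairing (- a) x = - pairing a x.
Proof. by rewrite /pairing mulmxN mxE. Qed.
Lemma pairing0l x : pairing 0 x = 0.
Proof. by rewrite /pairing mulmx0 mxE. Qed.
Lemma pairing_sum a (J : finType) (F : J -> V) :
  pairing a (\sum_j F j) = \sum_j pairing a (F j).
Proof. by rewrite /pairing mulmx_suml summxE. Qed.

Lemma fm1 (I : finType) (c b : I -> R) :
  (exists t, forall i, c i * t <= b i) <->
  (forall i, c i = 0 -> 0 <= b i) /\
  (forall i j, 0 < c i -> c j < 0 -> 0 <= c i * b j - c j * b i).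
Proof.
split=> [[t ht]|[h0 h]].
  split=> [i ci0|i j ci cj]; first by have := ht i; rewrite ci0 mul0r.
  by have hi := ht i; have hj := ht j; nra.
have leP i t : 0 < c i -> t <= b i / c i -> c i * t <= b i.
  by move=> ci; rewrite ler_pdivlMr // mulrC.
have geP i t : c i < 0 -> b i / c i <= t -> c i * t <= b i.
  by move=> ci; rewrite ler_ndivrMr // mulrC.
have [/existsP[j0 cj0]|/existsPn nlow] := boolP [exists j, c j < 0].
  exists (\big[Order.max/b j0 / c j0]_(j | c j < 0) (b j / c j)) => i.
  have [ci|ci|ci] := ltgtP (c i) 0; last by rewrite ci mul0r; apply: h0.
    by apply: geP => //; apply: le_bigmax_cond.
  apply: leP => //; have hb j : c j < 0 -> b j / c j <= b i / c i.
    move=> cj; rewrite ler_ndivrMr // mulrAC ler_pdivrMr //.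
    by have := h i j ci cj; nra.
  by apply/bigmax_leP; split=> [|j cj]; apply: hb.
exists (\big[Order.min/0]_(i | 0 < c i) (b i / c i)) => i.
have [ci|ci|ci] := ltgtP (c i) 0; last by rewrite ci mul0r; apply: h0.
  by have := nlow i; rewrite ci.
by apply: leP => //; apply: bigmin_le_cond.
Qed.

Lemma fm_step (I : finType) (k : nat) (a : I -> 'cV[R]_n)
    (c : I -> 'I_k.+1 -> R) (b : I -> R) :
  exists (I' : finType) (a' : I' -> 'cV[R]_n) (c' : I' -> 'I_k -> R) (b' : I' -> R),
  forall x (y : 'I_k -> R),
  (exists t, forall i,
     pairing (a i) x + (c i ord0 * t + \sum_(j < k) c i (lift ord0 j) * y j) <= b i)
  <-> (forall i, pairing (a' i) x + \sum_(j < k) c' i j * y j <= b' i).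
Proof.
pose c0 i := c i ord0.
pose g (T : lmodType R) (f : I -> T) (e : I + I * I) : T := match e with
  | inl i => (c0 i == 0)%:R *: f i
  | inr (i, j) => ((0 < c0 i) && (c0 j < 0))%:R *: (c0 i *: f j - c0 j *: f i)
  end.
exists (I + I * I)%type, (g _ a), (fun e j => g R^o (fun i => c i (lift ord0 j)) e),
  (g R^o b) => x y.
pose B i := b i - pairing (a i) x - \sum_(j < k) c i (lift ord0 j) * y j.
have gB e : g R^o b e - (pairing (g _ a e) x +
     \sum_(j < k) g R^o (fun i => c i (lift ord0 j)) e * y j) = g R^o B e.
  have gl (p q : R) i i' : \sum_(j < k) (p * c i (lift ord0 j) - q * c i' (lift ord0 j)) * y j
     = p * (\sum_(j < k) c i (lift ord0 j) * y j) - q * (\sum_(j < k) c i' (lift ord0 j) * y j).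
    rewrite !mulr_sumr -sumrB; apply: eq_bigr => j _; ring.
  case: e => [i|[i j]] /=.
    rewrite pairingZl (eq_bigr (fun j => (c0 i == 0)%:R * (c i (lift ord0 j) * y j))).
      by rewrite -mulr_sumr /B /GRing.scale /=; ring.
    by move=> j _; rewrite /GRing.scale /= mulrA.
  rewrite pairingZl pairingDl pairingNl !pairingZl.
  under eq_bigr => l _ do rewrite -mulrA.
  rewrite -mulr_sumr gl /B /GRing.scale /=; ring.
split=> [[t ht] e|h].
  rewrite -subr_ge0 gB.
  have hB i : c0 i * t <= B i by have := ht i; rewrite /B /c0; lra.
  have [h0 h1] := (fm1 c0 B).1 (ex_intro _ t hB).
  case: e => [i|[i j]] /=.
    by case: eqP => [/h0 ?|_]; rewrite ?scale0r // scale1r.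
  case: andP => [[? ?]|_]; rewrite ?scale0r // scale1r; exact: h1.
have /fm1 [t ht] : (forall i, c0 i = 0 -> 0 <= B i) /\
  (forall i j, 0 < c0 i -> c0 j < 0 -> 0 <= c0 i * B j - c0 j * B i).
  split=> [i ci|i j ci cj].
    by have := h (inl i); rewrite -subr_ge0 gB /= ci eqxx scale1r.
  by have := h (inr (i, j)); rewrite -subr_ge0 gB /= ci cj scale1r.
by exists t => i; have := ht i; rewrite /B /c0; lra.
Qed.

Lemma fm (k : nat) (I : finType) (a : I -> 'cV[R]_n) (c : I -> 'I_k -> R) (b : I -> R) :
  exists (I' : finType) (a' : I' -> 'cV[R]_n) (b' : I' -> R), forall x,
  (exists y : 'I_k -> R, forall i, pairing (a i) x + \sum_(j < k) c i j * y j <= b i)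
  <-> (forall i, pairing (a' i) x <= b' i).
Proof.
elim: k I a c b => [|k IH] I a c b.
  exists I, a, b => x; split=> [[y hy] i|h]; first by have := hy i; rewrite big_ord0 addr0.
  by exists (fun=> 0) => i; rewrite big_ord0 addr0.
have [I1 [a1 [c1 [b1 h1]]]] := fm_step a c b.
have [I2 [a2 [b2 h2]]] := IH I1 a1 c1 b1.
exists I2, a2, b2 => x; rewrite -h2; split=> [[y hy]|[y /h1[t ht]]].
  exists (fun j => y (lift ord0 j)); apply/h1; exists (y ord0) => i.
  by have := hy i; rewrite big_ord_recl.
exists (fun j => if unlift ord0 j is Some j' then y j' else t) => i.
rewrite big_ord_recl unlift_none; apply: le_trans (ht i).
by rewrite lerD2l lerD2l; apply: ler_sum => j _; rewrite liftK.
Qed.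

Definition polyhedral P := exists (I : finType) (a : I -> 'cV[R]_n) (b : I -> R),
  forall x, P x <-> forall i, pairing (a i) x <= b i.

Lemma polyhedral_polytope P :
  P !=set0 -> compact P -> polyhedral P -> polytope P.
Proof.
move=> [p Pp] cP [I [a [b hP]]]; split=> //.
exists {i | a i != 0}, (fun i => a (val i)), (fun i => b (val i)).
split=> [[i ai] //|]; apply/seteqP; split=> [x /hP h i _|x h]; first exact: h.
apply/hP => i; have [ai|ai] := eqVneq (a i) 0.
  by have := (hP p).1 Pp i; rewrite ai !pairing0l.
by apply: (h (exist _ i ai)).
Qed.

Lemma polytope_polyhedral P : polytope P -> polyhedral P.
Proof.
move=> [_ [I [a [b [_ ->]]]]]; exists I, a, b => x.
by split=> [h i|h i _]; apply: h.
Qed.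

Lemma closed_polyhedral P : polyhedral P -> closed P.
Proof.
move=> [I [a [b hP]]].
have -> : P = \bigcap_(i in setT) halfspace (a i) (b i).
  by apply/seteqP; split=> [x /hP h i _|x h]; [exact: h|apply/hP => i; exact: h].
apply: closed_bigI => i _.
apply: (@closed_comp _ _ (pairing (a i)) [set t | t <= b i]); last exact: closed_le.
move=> x _; rewrite /pairing.
have -> : (fun y : V => (y *m a i) 0 0) = (fun y => \sum_j y 0 j * a i j 0).
  by apply/funext => y; rewrite mxE.
apply: (continuous_big add_continuous) => j _ y.
by apply: continuousM; [exact: coord_continuous|exact: cst_continuous].
Qed.

Definition comb (J : finType) (v : J -> V) : set V :=
  [set x | exists2 l : J -> R, (forall j, 0 <= l j) /\ \sum_j l j = 1 &
                              x = \sum_j l j *: v j].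

Lemma sub_hull P : P `<=` convex_hull P.
Proof. exact: sub_gen_smallest. Qed.

Lemma convex_setP P : @convex_set R V P <->
  (forall x y t, P x -> P y -> 0 <= t -> t <= 1 -> P (t *: x + (1 - t) *: y)).
Proof.
split=> [cP x y t Px Py t0 t1|cP x y t].
  by have := cP x y (Itv01 t0 t1); rewrite !inE; apply.
by rewrite !inE => Px Py; apply: cP.
Qed.

Lemma hull_min P Q : @convex_set R V Q -> P `<=` Q -> convex_hull P `<=` Q.
Proof. exact: smallest_sub. Qed.

Lemma convex_set_hull P : @convex_set R V (convex_hull P).
Proof.
apply/convex_setP => x y t hx hy t0 t1 C [cC PC].
have /convex_setP := cC; apply=> //; [exact: hx|exact: hy].
Qed.

Lemma convex_comb (J : finType) (v : J -> V) : @convex_set R V (comb v).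
Proof.
apply/convex_setP => _ _ t [l [l0 l1] ->] [m [m0 m1] ->] t0 t1.
exists (fun j => t * l j + (1 - t) * m j); first split=> [j|].
- by rewrite addr_ge0 // mulr_ge0 // subr_ge0.
- by rewrite big_split -!mulr_sumr /= l1 m1; ring.
rewrite !scaler_sumr -big_split; apply: eq_bigr => j _.
by rewrite /= [RHS]scalerDl !scalerA.
Qed.

Lemma convex_sum (J : eqType) (v : J -> V) (l : J -> R) P (s : seq J) :
  @convex_set R V P -> (forall j, P (v j)) -> (forall j, 0 <= l j) ->
  0 < \sum_(j <- s) l j ->
  P ((\sum_(j <- s) l j)^-1 *: \sum_(j <- s) l j *: v j).
Proof.
move=> /convex_setP cP Pv l0; elim: s => [|j s IH]; first by rewrite big_nil ltxx.
rewrite !big_cons; set S := \sum_(i <- s) l i; set W := \sum_(i <- s) l i *: v i.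
have S0 : 0 <= S by apply: sumr_ge0.
move=> lS; have [e|nS] := eqVneq S 0.
  have -> : W = 0.
    rewrite /W big1_seq // => i /andP[_ si].
    move/eqP: e; rewrite psumr_eq0 // => /allP /(_ _ si) /eqP ->.
    by rewrite scale0r.
  rewrite e !addr0 scalerA mulVf ?scale1r //.
  by move: lS; rewrite e addr0 lt0r => /andP[].
have Sgt : 0 < S by rewrite lt0r nS.
have n0 : l j + S != 0 by rewrite gt_eqF.
have -> : (l j + S)^-1 *: (l j *: v j + W) =
  (l j / (l j + S)) *: v j + (1 - l j / (l j + S)) *: (S^-1 *: W).
  rewrite scalerDr !scalerA; congr (_ *: _ + _ *: _); field; by rewrite ?n0 ?nS.
apply: cP => //; first exact: IH.
  by rewrite divr_ge0 // addr_ge0.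
by rewrite ler_pdivrMr // mul1r lerDl.
Qed.

Lemma hull_comb (J : finType) (v : J -> V) : convex_hull (range v) = comb v.
Proof.
apply/seteqP; split.
  apply: hull_min; first exact: convex_comb.
  move=> _ [j _ <-]; exists (fun i => (i == j)%:R); first split=> //.
    by rewrite (bigD1 j) //= eqxx big1 ?addr0 // => i /negbTE ->.
  rewrite (bigD1 j) //= eqxx scale1r big1 ?addr0 // => i /negbTE ->.
  by rewrite scale0r.
move=> _ [l [l0 l1] ->].
have := @convex_sum _ v l (convex_hull (range v)) (index_enum J) (@convex_set_hull _).
rewrite l1 invr1 scale1r; apply=> // j.
by apply: sub_hull; exists j.
Qed.

Lemma polyhedral_proj k (I : finType) (a : I -> 'cV[R]_n) (c : I -> 'I_k -> R)
    (b : I -> R) P :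
  (forall x, P x <-> exists y : 'I_k -> R,
      forall i, pairing (a i) x + \sum_(j < k) c i j * y j <= b i) ->
  polyhedral P.
Proof.
move=> hP; have [I' [a' [b' h]]] := fm a c b.
by exists I', a', b' => x; rewrite hP.
Qed.

Lemma pairingE a x : pairing a x = \sum_j x 0 j * a j 0.
Proof. by rewrite /pairing mxE. Qed.

Lemma pairing_delta i x : pairing (delta_mx i 0) x = x 0 i.
Proof.
rewrite pairingE (bigD1 i) //= mxE !eqxx mulr1 big1 ?addr0 // => j /negbTE ji.
by rewrite mxE ji mulr0.
Qed.

Lemma polyhedral_hull (J : finType) (v : J -> V) : polyhedral (convex_hull (range v)).
Proof.
rewrite hull_comb; pose k := #|J|; pose w (i : 'I_k) := v (enum_val i).
pose I : finType := ('I_k + (bool + 'I_n * bool))%type.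
pose a (i : I) : 'cV[R]_n := match i with
  | inl _ => 0 | inr (inl _) => 0
  | inr (inr (i, e)) => (-1) ^+ e *: delta_mx i 0 end.
pose c (i : I) (j : 'I_k) : R := match i with
  | inl i => - (i == j)%:R | inr (inl e) => (-1) ^+ e
  | inr (inr (i, e)) => - ((-1) ^+ e * w j 0 i) end.
pose b (i : I) : R := match i with
  | inl _ => 0 | inr (inl e) => (-1) ^+ e | inr (inr _) => 0 end.
have s1 (y : 'I_k -> R) i : \sum_(j < k) - (i == j)%:R * y j = - y i.
  rewrite (bigD1 i) //= eqxx big1 ?addr0 ?mulN1r // => j.
  by rewrite eq_sym => /negbTE ->; rewrite oppr0 mul0r.
have s2 (y : 'I_k -> R) i e :
    \sum_(j < k) - ((-1) ^+ e * w j 0 i) * y j = - ((-1) ^+ e * (\sum_j y j *: w j) 0 i).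
  rewrite summxE mulr_sumr -sumrN; apply: eq_bigr => j _; rewrite mxE; ring.
have reind (l : J -> R) : \sum_j l j *: v j = \sum_(j < k) l (enum_val j) *: w j.
  by rewrite (reindex _ (onW_bij _ (enum_val_bij J))).
have reind1 (l : J -> R) : \sum_j l j = \sum_(j < k) l (enum_val j).
  by rewrite (reindex _ (onW_bij _ (enum_val_bij J))).
apply: (@polyhedral_proj k I a c b) => x; split.
  move=> [l [l0 l1] xE]; exists (fun j => l (enum_val j)) => -[i|[e|[i e]]] /=.
  - by rewrite pairing0l add0r s1 oppr_le0.
  - by rewrite pairing0l add0r -mulr_sumr -reind1 l1 mulr1.
  - by rewrite pairingZl pairing_delta s2 -reind -xE subrr.
move=> [y hy]; exists (fun j => y (enum_rank j)); first split=> [j|].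
- by have := hy (inl (enum_rank j)); rewrite /= pairing0l add0r s1 oppr_le0.
- rewrite reind1; under eq_bigr do rewrite enum_valK.
  have := hy (inr (inl false)); have := hy (inr (inl true)).
  rewrite /= !pairing0l !add0r -!mulr_sumr expr1 expr0; lra.
rewrite reind; under eq_bigr do rewrite enum_valK.
apply/rowP => i.
have := hy (inr (inr (i, false))); have := hy (inr (inr (i, true))).
by rewrite /= !pairingZl !pairing_delta !s2 expr1 expr0; lra.
Qed.

Lemma compact_hull (J : finType) (v : J -> V) : compact (convex_hull (range v)).
Proof.
pose M i := \sum_j `|v j 0 i|.
apply: (@subclosed_compact _ (convex_hull (range v)) [set x : V | forall i, `[- M i, M i]%classic (x ord0 i)]).
- by apply: closed_polyhedral; exact: polyhedral_hull.
- exact: (@rV_compact R n (fun i => `[- M i, M i]%classic) (fun i => @segment_compact R _ _)).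
rewrite hull_comb => x [l [l0 l1] xE] i /=.
rewrite in_itv /= -ler_norml xE summxE.
apply: le_trans (ler_norm_sum _ _ _) _; apply: ler_sum => j _.
rewrite mxE normrM ger0_norm // -[leRHS]mul1r ler_wpM2r //.
by rewrite -l1 (bigD1 j) //= lerDl sumr_ge0.
Qed.

Lemma integral_hull (J : finType) (v : J -> V) :
  (forall j, lattice (v j)) -> integral_vertices (convex_hull (range v)).
Proof.
move=> vL x [a fx].
have [hx xmin] : face a (convex_hull (range v)) x by rewrite fx.
move: (hx); rewrite hull_comb => -[l [l0 l1] xE].
have [j hj] : exists j, pairing a (v j) <= pairing a x.
  apply: contrapT => /forallNP nle.
  have : pairing a x < pairing a x; last by rewrite ltxx.
  have lt j : pairing a x < pairing a (v j) by rewrite ltNge; apply/negP/nle.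
  have [j lj] : exists j, l j != 0.
    apply: contrapT => /forallNP h; move: l1; rewrite big1 => [/eqP|j _].
      by rewrite eq_sym oner_eq0.
    by apply/eqP/negPn/negP/h.
  rewrite {2}xE pairing_sum -[ltLHS]mul1r -l1 mulr_suml.
  under [ltRHS]eq_bigr do rewrite pairingZr.
  rewrite (bigD1 j) //= [ltRHS](bigD1 j) //= ltr_leD //.
    by rewrite ltr_pM2l // lt0r lj l0.
  by apply: ler_sum => i _; rewrite ler_wpM2l // ltW.
suff : face a (convex_hull (range v)) (v j) by rewrite fx => <-; exact: vL.
split=> [|y hy]; first by apply: sub_hull; exists j.
exact: le_trans hj (xmin _ hy).
Qed.

Lemma polyhedral_minkowski P Q :
  polyhedral P -> polyhedral Q -> polyhedral (minkowski_sum P Q).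
Proof.
move=> [I [a [b hP]]] [J [d [e hQ]]].
pose f (i : I + J) : 'cV[R]_n := match i with inl _ => 0 | inr j => d j end.
pose c (i : I + J) (l : 'I_n) : R :=
  match i with inl i => a i l 0 | inr j => - d j l 0 end.
pose g (i : I + J) : R := match i with inl i => b i | inr j => e j end.
have rowE (h : 'cV[R]_n) (y : 'I_n -> R) : \sum_j h j 0 * y j = pairing h (\row_j y j).
  by rewrite pairingE; apply: eq_bigr => j _; rewrite mxE mulrC.
have rowNE (h : 'cV[R]_n) (y : 'I_n -> R) : \sum_j - h j 0 * y j = - pairing h (\row_j y j).
  by rewrite -rowE -sumrN; apply: eq_bigr => j _; rewrite mulNr.
apply: (@polyhedral_proj n _ f c g) => x; split.
  move=> [p /hP Pp [q /hQ Qq <-]]; exists (fun j => p 0 j).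
  have pE : \row_j p 0 j = p by apply/rowP => j; rewrite mxE.
  move=> [i|j] /=; first by rewrite pairing0l add0r rowE pE.
  by rewrite rowNE pE pairingDr addrAC subrr add0r.
move=> [y hy]; exists (\row_j y j).
  by apply/hP => i; have := hy (inl i); rewrite /= pairing0l add0r rowE.
exists (x - \row_j y j); last by rewrite addrC subrK.
by apply/hQ => j; have := hy (inr j); rewrite /= rowNE pairingBr.
Qed.

Lemma compact_minkowski P Q : compact P -> compact Q -> compact (minkowski_sum P Q).
Proof.
move=> cP cQ.
have -> : minkowski_sum P Q = (fun z : V * V => z.1 + z.2) @` (P `*` Q).
  apply/seteqP; split=> [_ [x Px [y Qy <-]]|_ [[x y] [Px Qy] <-]].
    by exists (x, y).
  by exists x => //; exists y.
apply: continuous_compact; last exact: compact_setX.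
by apply: continuous_subspaceT => z; exact: add_continuous.
Qed.

Lemma lattice0 : lattice 0.
Proof. by exists 0 => //; rewrite map_mx0. Qed.

Lemma latticeD x y : lattice x -> lattice y -> lattice (x + y).
Proof. by move=> [z _ <-] [w _ <-]; exists (z + w) => //; rewrite map_mxD. Qed.

Lemma integral_minkowski P Q :
  integral_vertices P -> integral_vertices Q -> integral_vertices (minkowski_sum P Q).
Proof.
move=> iP iQ z [a fz].
have [[x Px [y Qy xy]] zmin] : face a (minkowski_sum P Q) z by rewrite fz.
rewrite -xy; apply: latticeD.
- apply: iP; exists a; apply/seteqP; split=> [x' [Px' x'min]|_ ->].
    have : face a (minkowski_sum P Q) (x' + y).
      split=> [|w hw]; first by exists x' => //; exists y.
      apply: le_trans (zmin _ hw).
      by rewrite -xy !pairingDr lerD2r; exact: x'min.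
    by rewrite fz -xy => /addIr.
  split=> // x' Px'; have := zmin (x' + y); rewrite -xy !pairingDr lerD2r.
  by apply; exists x' => //; exists y.
- apply: iQ; exists a; apply/seteqP; split=> [y' [Qy' y'min]|_ ->].
    have : face a (minkowski_sum P Q) (x + y').
      split=> [|w hw]; first by exists x => //; exists y'.
      apply: le_trans (zmin _ hw).
      by rewrite -xy !pairingDr lerD2l; exact: y'min.
    by rewrite fz -xy => /addrI.
  split=> // y' Qy'; have := zmin (x + y'); rewrite -xy !pairingDr lerD2l.
  by apply; exists x => //; exists y'.
Qed.

Lemma polytope_minkowski P Q : P !=set0 -> Q !=set0 ->
  polytope P -> polytope Q -> polytope (minkowski_sum P Q).
Proof.
move=> [x Px] [y Qy] hP hQ; apply: polyhedral_polytope.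
- by exists (x + y), x => //; exists y.
- by apply: compact_minkowski; [case: hP|case: hQ].
- by apply: polyhedral_minkowski; apply: polytope_polyhedral.
Qed.

Lemma minkowskiC : commutative minkowski_sum.
Proof.
move=> P Q; apply/seteqP; split=> [_ [x Px [y Qy <-]]|_ [x Px [y Qy <-]]];
  by exists y => //; exists x => //; rewrite addrC.
Qed.

Lemma minkowskiA : associative minkowski_sum.
Proof.
move=> P Q S; apply/seteqP; split.
  move=> _ [x Px [_ [y Qy [z Sz <-]] <-]].
  by exists (x + y); [exists x => //; exists y|exists z => //; rewrite addrA].
move=> _ [_ [x Px [y Qy <-]] [z Sz <-]].
by exists x => //; exists (y + z); [exists y => //; exists z|rewrite addrA].
Qed.

Lemma minkowski0 : left_id [set 0] minkowski_sum.
Proof.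
move=> P; apply/seteqP; split=> [_ [_ -> [x Px <-]]|x Px]; first by rewrite add0r.
by exists 0 => //; exists x => //; rewrite add0r.
Qed.

Lemma polytope_hull (J : finType) (v : J -> V) (j : J) : polytope (convex_hull (range v)).
Proof.
apply: polyhedral_polytope.
- by exists (v j); apply: sub_hull; exists j.
- exact: compact_hull.
- exact: polyhedral_hull.
Qed.

Lemma hull_nonempty P : P !=set0 -> convex_hull P !=set0.
Proof. by move=> [x Px]; exists x; apply: sub_hull. Qed.

Lemma convex_set1 x : @convex_set R V [set x].
Proof.
apply/convex_setP => _ _ t -> -> _ _.
by rewrite /= -scalerDl addrC subrK scale1r.
Qed.

Lemma hull1 x : convex_hull [set x] = [set x].
Proof.
by apply/seteqP; split; [apply: hull_min => //; exact: convex_set1|exact: sub_hull].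
Qed.

Lemma set1_range x : [set x] = convex_hull (range (fun _ : unit => x)).
Proof.
rewrite -[LHS]hull1; congr convex_hull; apply/seteqP; split=> [_ ->|_ [_ _ <-] //].
by exists tt.
Qed.

Lemma polytope_set1 x : polytope [set x].
Proof. by rewrite set1_range; exact: (@polytope_hull unit _ tt). Qed.

Lemma integral_set1 x : lattice x -> integral_vertices [set x].
Proof. by move=> xL; rewrite set1_range; apply: integral_hull => -[]. Qed.

Lemma set1_nonempty x : [set x] !=set0.
Proof. by exists x. Qed.

Lemma minkowski_nonempty P Q : P !=set0 -> Q !=set0 -> minkowski_sum P Q !=set0.
Proof. by move=> [x Px] [y Qy]; exists (x + y), x => //; exists y. Qed.

Lemma ipolytope_inj (P Q : ipolytope) : P = Q :> set V -> P = Q.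
Proof.
case: P Q => [P p1 p2 p3] [Q q1 q2 q3] /= PQ; subst Q.
by congr IPolytope; exact: Prop_irrelevance.
Qed.

Definition ipoint x (xL : lattice x) : ipolytope :=
  IPolytope (polytope_set1 x) (set1_nonempty x) (integral_set1 xL).

Definition ipoly_add (P Q : ipolytope) : ipolytope :=
  IPolytope
    (polytope_minkowski (ipoly_nonempty P) (ipoly_nonempty Q)
       (ipoly_poly P) (ipoly_poly Q))
    (minkowski_nonempty (ipoly_nonempty P) (ipoly_nonempty Q))
    (integral_minkowski (@ipoly_integral P) (@ipoly_integral Q)).

HB.instance Definition _ := gen_eqMixin ipolytope.
HB.instance Definition _ := gen_choiceMixin ipolytope.

Lemma ipoly_addA : associative ipoly_add.
Proof. by move=> P Q S; apply: ipolytope_inj; exact: minkowskiA. Qed.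
Lemma ipoly_addC : commutative ipoly_add.
Proof. by move=> P Q; apply: ipolytope_inj; exact: minkowskiC. Qed.
Lemma ipoly_add0 : left_id (ipoint lattice0) ipoly_add.
Proof. by move=> P; apply: ipolytope_inj; exact: minkowski0. Qed.

HB.instance Definition _ := GRing.isNmodule.Build ipolytope
  ipoly_addA ipoly_addC ipoly_add0.

End Polytopes.

(* Grothendieck group of a commutative monoid: (P, Q) stands for P - Q. *)
Section Grothendieck.
Variable M : nmodType.
Implicit Types x y z : M * M.

Definition groth_eq x y : bool :=
  `[< exists e, x.1 + y.2 + e = y.1 + x.2 + e >].

Lemma groth_eq_refl : reflexive groth_eq.
Proof. by move=> x; apply/asboolP; exists 0. Qed.

Lemma groth_eq_sym : symmetric groth_eq.
Proof. by move=> x y; apply/asboolP/asboolP => -[e xy]; exists e. Qed.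

Lemma groth_eq_trans : transitive groth_eq.
Proof.
move=> y x z /asboolP[e xy] /asboolP[f yz]; apply/asboolP.
exists (y.2 + e + f).
rewrite (AC (2*3) (1*3*4*(2*5))) /= xy (AC (3*2) (1*4*5*(2*3))) /= yz.
by rewrite (AC (3*2) (1*4*(2*5*3))).
Qed.

Canonical groth_equiv :=
  EquivRel groth_eq groth_eq_refl groth_eq_sym groth_eq_trans.

Definition grothendieck := {eq_quot groth_eq}.
HB.instance Definition _ : EqQuotient _ groth_eq grothendieck :=
  EqQuotient.on grothendieck.
HB.instance Definition _ := Choice.on grothendieck.

Definition gdiff (P Q : M) : grothendieck := \pi_grothendieck (P, Q).

Lemma gdiff_eq P Q P' Q' :
  gdiff P Q = gdiff P' Q' <-> exists e, P + Q' + e = P' + Q + e.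
Proof.
by rewrite /gdiff; split=> [/eqmodP/asboolP|h]; last apply/eqmodP/asboolP.
Qed.

Lemma gdiffE (X : grothendieck) : X = gdiff (repr X).1 (repr X).2.
Proof. by rewrite /gdiff -surjective_pairing reprK. Qed.

Definition groth_zero := gdiff 0 0.
Definition groth_opp (X : grothendieck) := gdiff (repr X).2 (repr X).1.
Definition groth_add (X Y : grothendieck) :=
  gdiff ((repr X).1 + (repr Y).1) ((repr X).2 + (repr Y).2).

Lemma groth_addE P Q P' Q' :
  groth_add (gdiff P Q) (gdiff P' Q') = gdiff (P + P') (Q + Q').
Proof.
have /gdiff_eq[e he] := gdiffE (gdiff P Q).
have /gdiff_eq[f hf] := gdiffE (gdiff P' Q').
apply/gdiff_eq; exists (e + f).
rewrite (AC (2*2*2) ((1*3*5)*(2*4*6))) /= -he -hf.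
by rewrite (AC (3*3) ((1*4)*(2*5)*(3*6))).
Qed.

Lemma groth_oppE P Q : groth_opp (gdiff P Q) = gdiff Q P.
Proof.
have /gdiff_eq[e he] := gdiffE (gdiff P Q).
by apply/gdiff_eq; exists e; rewrite [_ + P]addrC he [Q + _]addrC.
Qed.

Lemma groth_addA : associative groth_add.
Proof.
move=> X Y Z; rewrite (gdiffE X) (gdiffE Y) (gdiffE Z).
by rewrite !groth_addE !addrA.
Qed.

Lemma groth_addC : commutative groth_add.
Proof.
by move=> X Y; rewrite (gdiffE X) (gdiffE Y) !groth_addE; congr gdiff; exact: addrC.
Qed.

Lemma groth_add0 : left_id groth_zero groth_add.
Proof. by move=> X; rewrite (gdiffE X) groth_addE !add0r. Qed.

Lemma groth_addN : left_inverse groth_zero groth_opp groth_add.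
Proof.
move=> X; rewrite (gdiffE X) groth_oppE groth_addE.
by apply/gdiff_eq; exists 0; rewrite !addr0 add0r addrC.
Qed.

HB.instance Definition _ := GRing.isZmodule.Build grothendieck
  groth_addA groth_addC groth_add0 groth_addN.

Lemma gdiffD P Q P' Q' : gdiff P Q + gdiff P' Q' = gdiff (P + P') (Q + Q').
Proof. exact: groth_addE. Qed.

Lemma gdiffN P Q : - gdiff P Q = gdiff Q P.
Proof. exact: groth_oppE. Qed.

End Grothendieck.
(* A skew-field of right fractions of S. It is determined by S up to unique
   isomorphism over S. *)
Record ore_localisation (S : nzRingType) := OreLocalisation {
  ore_field :> unitRingType;
  ore_skew : GRing.field_axiom ore_field;
  ore_emb : {rmorphism S -> ore_field};
  ore_emb_inj : injective ore_emb;
  ore_frac : forall d, exists pq : S * S,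
    pq.2 != 0 /\ d = ore_emb pq.1 / ore_emb pq.2
}.

Section Dieudonne.
Variable D : unitRingType.
Implicit Types x y z c d : D.

(* The commutator subgroup [D^x, D^x]. Inverses need not be added, as the inverse
   of a commutator is a commutator. *)
Inductive comm_sub : D -> Prop :=
| comm_sub1 : comm_sub 1
| comm_subM c x y : comm_sub c -> x \is a GRing.unit -> y \is a GRing.unit ->
    comm_sub (c * (x * y * x^-1 * y^-1)).

Lemma comm_sub_unit c : comm_sub c -> c \is a GRing.unit.
Proof.
elim=> [|{}c x y _ cu xu yu]; first exact: unitr1.
by rewrite !unitrMl ?unitrV.
Qed.

Lemma comm_sub_mul c d : comm_sub c -> comm_sub d -> comm_sub (c * d).
Proof.
move=> hc; elim=> [|{}d x y _ IH xu yu]; first by rewrite mulr1.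
by rewrite mulrA; apply: comm_subM.
Qed.

Lemma comm_sub_inv c : comm_sub c -> comm_sub c^-1.
Proof.
elim=> [|{}c x y hc IH xu yu]; first by rewrite invr1; exact: comm_sub1.
have cu := comm_sub_unit hc.
rewrite !invrM ?unitrMl ?unitrV // !invrK !mulrA.
apply: comm_sub_mul => //; rewrite -[_ * _]mul1r.
by apply: comm_subM => //; exact: comm_sub1.
Qed.

Definition ab_eq x y : bool := `[< exists2 c, comm_sub c & x = c * y >].

Lemma ab_eq_refl : reflexive ab_eq.
Proof. by move=> x; apply/asboolP; exists 1; [exact: comm_sub1|rewrite mul1r]. Qed.

Lemma ab_eq_sym : symmetric ab_eq.
Proof.
move=> x y; apply/asboolP/asboolP => -[c hc ->]; exists c^-1.
- exact: comm_sub_inv.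
- by rewrite mulKr ?comm_sub_unit.
- exact: comm_sub_inv.
- by rewrite mulKr ?comm_sub_unit.
Qed.

Lemma ab_eq_trans : transitive ab_eq.
Proof.
move=> y x z /asboolP[c hc ->] /asboolP[d hd ->]; apply/asboolP.
by exists (c * d); [exact: comm_sub_mul|rewrite mulrA].
Qed.

Canonical ab_equiv := EquivRel ab_eq ab_eq_refl ab_eq_sym ab_eq_trans.

(* For a skew-field D this is D^x / [D^x, D^x] together with the class {0} of 0. *)
Definition abelianised := {eq_quot ab_eq}.
HB.instance Definition _ : EqQuotient _ ab_eq abelianised :=
  EqQuotient.on abelianised.
HB.instance Definition _ := Choice.on abelianised.

(* A representative of the Dieudonne determinant by Gaussian elimination: choose
   a pivot in the first column, move its row to the top (which contributes a
   sign), and continue with the Schur complement, which is what remains after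
   left multiplication by elementary matrices has cleared the column. For a
   skew-field, the class in abelianised D does not depend on the pivots. *)
Fixpoint dieudonne_rep (m : nat) : 'M[D]_m -> D :=
  match m with
  | 0 => fun=> 1
  | m'.+1 => fun A : 'M[D]_(1 + m') =>
      if [pick i | A i 0 != 0] is Some i then
        let B : 'M[D]_(1 + m') := xrow i 0 A in
        (-1) ^+ (i != 0) * A i 0 *
          dieudonne_rep (drsubmx B - dlsubmx B *m (A i 0)^-1%:M *m ursubmx B)
      else 0
  end.

Definition dieudonne (m : nat) (A : 'M[D]_m) : abelianised :=
  \pi_abelianised (dieudonne_rep A).

End Dieudonne.

Section HullSum.
Variables (R : realType) (n : nat).
Local Notation V := 'rV[R]_n.

Let N (x : V) : R := \sum_i x 0 i ^+ 2.

Let NP (x y z : V) : x + y = z + z -> N x <= N z -> N y <= N z -> x = y.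
Proof.
move=> xyz hx hy.
have e : N x + N y + N x + N y = N z + N z + N z + N z + N (x - y).
  have <- : N (x + y) = N z + N z + N z + N z.
    by rewrite xyz /N -!big_split; apply: eq_bigr => i _; rewrite !mxE /=; ring.
  by rewrite /N -!big_split; apply: eq_bigr => i _; rewrite !mxE /=; ring.
have N0 : N (x - y) = 0.
  apply/eqP; rewrite eq_le; apply/andP; split; first by lra.
  by apply: sumr_ge0 => i _; exact: sqr_ge0.
apply/rowP => i; apply/eqP; rewrite -subr_eq0 -sqrf_eq0.
move/eqP: N0; rewrite psumr_eq0 => [/allP /(_ i)|j _]; last exact: sqr_ge0.
by rewrite mem_index_enum !mxE => /(_ isT).
Qed.

Lemma convex_halfspace a (b : R) : @convex_set R V (halfspace a b).
Proof.
apply/convex_setP => x y t; rewrite /halfspace /= => hx hy t0 t1.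
by rewrite pairingDr !pairingZr; nra.
Qed.

Lemma convex_minkowski (P Q : set V) :
  @convex_set R V P -> @convex_set R V Q -> @convex_set R V (minkowski_sum P Q).
Proof.
move=> /convex_setP cP /convex_setP cQ; apply/convex_setP.
move=> _ _ t [x Px [y Qy <-]] [x' Px' [y' Qy' <-]] t0 t1.
exists (t *: x + (1 - t) *: x'); first exact: cP.
exists (t *: y + (1 - t) *: y'); first exact: cQ.
by rewrite !scalerDr addrACA.
Qed.

Lemma hull_minkowski (J L M : finType) (v : J -> V) (w : L -> V) (u : M -> V) :
  injective v -> injective w ->
  (forall m, exists j l, u m = v j + w l) ->
  (forall j l, (forall j' l', v j' + w l' = v j + w l -> j' = j /\ l' = l) ->
     exists m, u m = v j + w l) ->
  (0 < #|J|)%N -> (0 < #|L|)%N ->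
  convex_hull (range u) = minkowski_sum (convex_hull (range v)) (convex_hull (range w)).
Proof.
move=> vi wi uvw uniq /card_gt0P[j0 _] /card_gt0P[l0 _]; apply/seteqP; split.
  apply: hull_min; first by apply: convex_minkowski; exact: convex_set_hull.
  move=> _ [m _ <-]; have [j [l ->]] := uvw m.
  by exists (v j); [apply: sub_hull; exists j|exists (w l) => //; apply: sub_hull; exists l].
have [I [a [b hP]]] := polyhedral_hull u.
move=> _ [x hx [y hy <-]]; apply/hP => i.
pose f (p : J * L) := pairing (a i) (v p.1 + w p.2).
pose p0 := [arg max_(p > (j0, l0)) f p]%O.
have f0 p : f p <= f p0.
  by rewrite /p0; case: Order.TotalTheory.arg_maxP => // q _ /(_ p isT).
pose g (p : J * L) := N (v p.1 + w p.2).
have [[j l] /eqP fp gp] : exists2 p, f p == f p0 & forall q, f q = f p0 -> g q <= g p.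
  have := @Order.TotalTheory.arg_maxP _ _ _ p0 (fun p => f p == f p0) g (eqxx _).
  by case=> p fp gp; exists p => // q /eqP /gp.
have [m um] : exists m, u m = v j + w l.
  apply: uniq => j' l' e.
  have s : f (j, l') + f (j', l) = f p0 + f p0.
    rewrite -fp /f /= -!pairingDr addrACA [in w l' + w l]addrC addrACA e.
    by rewrite pairingDr.
  have h1 := f0 (j, l'); have h2 := f0 (j', l).
  have e1 : f (j, l') = f p0 by lra.
  have e2 : f (j', l) = f p0 by lra.
  have st : (v j + w l') + (v j' + w l) = (v j + w l) + (v j + w l).
    by rewrite addrACA [w l' + _]addrC addrACA e.
  have := NP st (gp _ e1) (gp _ e2); move=> e3.
  suff wl : w l' = w l.
    by split; [apply: vi; move: e; rewrite wl => /addIr|exact: wi].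
  apply/rowP => k; move/rowP/(_ k): e3; move/rowP/(_ k): e; rewrite !mxE; lra.
have hv : pairing (a i) x <= pairing (a i) (v j).
  apply: (@hull_min _ _ _ (halfspace (a i) (pairing (a i) (v j)))) hx.
    exact: convex_halfspace.
  move=> _ [j' _ <-] /=; have := f0 (j', l).
  by rewrite -fp /f /= !pairingDr lerD2r.
have hw : pairing (a i) y <= pairing (a i) (w l).
  apply: (@hull_min _ _ _ (halfspace (a i) (pairing (a i) (w l)))) hy.
    exact: convex_halfspace.
  move=> _ [l' _ <-] /=; have := f0 (j, l').
  by rewrite -fp /f /= !pairingDr lerD2l.
have := (hP (u m)).1 (sub_hull (ex_intro2 _ _ m Logic.I erefl)) i.
by rewrite um !pairingDr; apply: le_trans; apply: lerD.
Qed.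

End HullSum.

Section Newton.
Variables (R : realType) (n : nat) (H : zmodType) (iota : H -> 'rV[int]_n).
Variables (K : unitRingType) (t : twisting K H).
Local Notation KH := (twgring t).
Local Notation PH := (grothendieck (ipolytope R n)).
Implicit Types p q : KH.

Definition lattice_emb (h : H) : 'rV[R]_n := map_mx intr (iota h).

Definition newton_set p : set 'rV[R]_n :=
  convex_hull [set lattice_emb h | h in [set h | p@_h != 0]].

Lemma newton_setE p :
  newton_set p = convex_hull (range (fun h : msupp p => lattice_emb (val h))).
Proof.
congr convex_hull; apply/seteqP; split=> [_ [h /= ph <-]|_ [h _ <-]].
  by rewrite mcoeff_neq0 in ph; exists (FSetSub ph).
by exists (val h) => //=; rewrite mcoeff_neq0 (valP h).
Qed.

Lemma msupp_point p : p != 0 -> exists h : msupp p, True.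
Proof.
move=> p0; case: (fset_0Vmem (msupp p)) => [p00|[h hp]].
  by move: p0; rewrite (tw_expand p) p00 big_seq_fset0 eqxx.
by exists (FSetSub hp).
Qed.

Lemma newton_polytope p : p != 0 -> polytope (newton_set p).
Proof.
by move=> /msupp_point[h _]; rewrite newton_setE; exact: polytope_hull h.
Qed.

Lemma newton_nonempty p : p != 0 -> newton_set p !=set0.
Proof.
move=> /msupp_point[h _]; rewrite newton_setE; apply: hull_nonempty.
by exists (lattice_emb (val h)), h.
Qed.

Lemma newton_integral p : integral_vertices (newton_set p).
Proof.
by rewrite newton_setE; apply: integral_hull => h; exists (iota (val h)).
Qed.

(* Convention: newton_poly 0 = 0, which is never used for the Newton polytope of
   an element of D. *)
Definition newton_poly p : ipolytope R n :=
  if pselect (p != 0) is left p0 then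
    IPolytope (newton_polytope p0) (newton_nonempty p0) (@newton_integral p)
  else 0.

Lemma newton_polyE p : p != 0 -> newton_poly p = newton_set p :> set _.
Proof. by rewrite /newton_poly; case: pselect. Qed.

Variable D : ore_localisation KH.
Local Notation j := (@ore_emb _ D).

Definition ore_num (d : D) : KH := (projT1 (cid (ore_frac d))).1.
Definition ore_den (d : D) : KH := (projT1 (cid (ore_frac d))).2.

Lemma ore_den_neq0 d : ore_den d != 0.
Proof. by rewrite /ore_den; case: cid => ? []. Qed.

Lemma ore_num_den d : d = j (ore_num d) / j (ore_den d).
Proof. by rewrite /ore_num /ore_den; case: cid => ? []. Qed.

(* None is the empty polytope P(0). By newton_frac the value does not depend on
   the fraction chosen for d; by newtonM it is a homomorphism on D^x. *)
Definition newton (d : D) : option PH :=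
  if d == 0 then None
  else Some (gdiff (newton_poly (ore_num d)) (newton_poly (ore_den d))).

(* By newton_abE the value does not depend on the representative. *)
Definition newton_ab (c : abelianised D) : option PH := newton (repr c).

Definition newton_mx (m : nat) (A : 'M[KH]_m) : option PH :=
  newton_ab (dieudonne (map_mx j A)).

Hypothesis K_skew : GRing.field_axiom K.
Hypothesis iota_inj : injective iota.
Hypothesis iotaD : {morph iota : x y / x + y}.

Lemma lattice_emb_inj : injective lattice_emb.
Proof.
move=> x y xy; apply: iota_inj; apply/rowP => i.
by move/rowP/(_ i): xy; rewrite !mxE => /intr_inj.
Qed.

Lemma lattice_embD : {morph lattice_emb : x y / x + y}.
Proof. by move=> x y; rewrite /lattice_emb iotaD map_mxD. Qed.

Lemma twgring_coefM p q h :
  (p * q)@_h = \sum_(g <- msupp p) \sum_(g' <- msupp q)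
    (p@_g * tw_act t g q@_g' * tw_coc t g g') *+ (g + g' == h).
Proof.
rewrite -[p * q]/(tw_mul p q) /tw_mul raddf_sum; apply: eq_bigr => g _.
by rewrite raddf_sum; apply: eq_bigr => g' _ /=; rewrite mcoeffU.
Qed.

Lemma twgring_suppM p q h : (p * q)@_h != 0 ->
  exists g g', [/\ g \in msupp p, g' \in msupp q & h = g + g'].
Proof.
move=> ph; apply: contrapT => no; move/eqP: ph; apply.
rewrite twgring_coefM big1_seq // => g /andP[_ gp].
rewrite big1_seq // => g' /andP[_ gq].
by case: eqP => // e; case: no; exists g, g'.
Qed.

Lemma twgring_coefM_uniq p q g g' : g \in msupp p -> g' \in msupp q ->
  (forall h h', h \in msupp p -> h' \in msupp q ->
     h + h' = g + g' -> h = g /\ h' = g') ->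
  (p * q)@_(g + g') != 0.
Proof.
move=> gp gq uniq; rewrite twgring_coefM.
rewrite (bigD1_seq g) ?fset_uniq //= [X in _ + X]big1_seq ?addr0; last first.
  move=> h /andP[hg hp]; rewrite big1_seq // => h' /andP[_ hq].
  case: eqP => // /(uniq _ _ hp hq) [] e.
  by rewrite e eqxx in hg.
rewrite (bigD1_seq g') ?fset_uniq //= [X in _ + X]big1_seq ?addr0; last first.
  move=> h' /andP[hg hq].
  case: eqP => // /(uniq _ _ gp hq) [] _ e.
  by rewrite e eqxx in hg.
rewrite eqxx mulr1n; apply: contraTneq isT => e0.
have : p@_g * tw_act t g q@_g' * tw_coc t g g' \is a GRing.unit.
  rewrite !unitrMl ?tw_coc_unit ?rmorph_unit //; apply: K_skew;
    by rewrite mcoeff_neq0.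
by rewrite e0 unitr0.
Qed.

Lemma newton_setM p q : p != 0 -> q != 0 ->
  newton_set (p * q) = minkowski_sum (newton_set p) (newton_set q).
Proof.
move=> p0 q0; rewrite !newton_setE; apply: hull_minkowski.
- by move=> x y /lattice_emb_inj /val_inj.
- by move=> x y /lattice_emb_inj /val_inj.
- move=> [h /= hpq]; move: (hpq); rewrite -mcoeff_neq0.
  move=> /twgring_suppM[g [g' [gp gq ->]]].
  by exists (FSetSub gp), (FSetSub gq); rewrite lattice_embD.
- move=> [g gp] [g' gq] /= uniq.
  have pq : g + g' \in msupp (p * q).
    rewrite -mcoeff_neq0; apply: twgring_coefM_uniq => // h h' hp hq e.
    have [] := uniq (FSetSub hp) (FSetSub hq); first by rewrite -!lattice_embD e.
    by move=> [->] [->].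
  by exists (FSetSub pq); rewrite lattice_embD.
- by have [h _] := msupp_point p0; apply/card_gt0P; exists h.
- by have [h _] := msupp_point q0; apply/card_gt0P; exists h.
Qed.

Lemma twgring_mul_neq0 p q : p != 0 -> q != 0 -> p * q != 0.
Proof.
move=> p0 q0; have := newton_nonempty p0; have := newton_nonempty q0.
move=> /minkowski_nonempty h /h{h}; rewrite minkowskiC -newton_setM //.
move=> [x]; apply: contraPneq => ->; rewrite newton_setE hull_comb.
move=> [l [_ l1] _]; move: l1; rewrite big1 => [/eqP|[i i0] _].
  by rewrite eq_sym oner_eq0.
by exfalso; rewrite msupp0 in i0.
Qed.

Lemma newton_polyM p q : p != 0 -> q != 0 ->
  newton_poly (p * q) = newton_poly p + newton_poly q.
Proof.
move=> p0 q0; apply: ipolytope_inj.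
rewrite newton_polyE ?twgring_mul_neq0 // newton_setM //.
by rewrite -!newton_polyE.
Qed.

Lemma ore_emb_neq0 p : p != 0 -> j p != 0.
Proof. by apply: contraNneq => e; apply/eqP/(@ore_emb_inj _ D); rewrite e rmorph0. Qed.

Lemma ore_emb_unit p : p != 0 -> j p \is a GRing.unit.
Proof. by move/ore_emb_neq0; exact: ore_skew. Qed.

Lemma ore_mul_eq0 (x y : D) : (x * y == 0) = (x == 0) || (y == 0).
Proof.
have [->|/ore_skew xu] := eqVneq x 0; first by rewrite mul0r eqxx.
by rewrite mulrI_eq0 //; exact: mulrI.
Qed.

Lemma ore_common (q p : KH) : q != 0 -> exists a b : KH,
  b != 0 /\ (j q)^-1 * j p = j a / j b /\ p * b = q * a.
Proof.
move=> q0; have [[a b] /= [b0 e]] := ore_frac ((j q)^-1 * j p).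
exists a, b; split=> //; split=> //; apply: (@ore_emb_inj _ D).
rewrite !rmorphM; apply: (canRL (mulVKr (ore_emb_unit q0))).
by rewrite mulrA e mulrVK ?ore_emb_unit.
Qed.

Lemma newton_frac p q : p != 0 -> q != 0 ->
  newton (j p / j q) = Some (gdiff (newton_poly p) (newton_poly q)).
Proof.
move=> p0 q0; set d := j p / j q.
have d0 : d != 0.
  by rewrite ore_mul_eq0 negb_or ore_emb_neq0 //= invr_eq0 ore_emb_neq0.
rewrite /newton (negbTE d0); congr Some.
have := ore_num_den d; have := ore_den_neq0 d.
move: (ore_num d) (ore_den d) => p' q' q'0 e.
have p'0 : p' != 0 by apply: contraNneq d0 => z; rewrite e z rmorph0 mul0r.
have [a [b [b0 [ab qb]]]] := ore_common q q'0.
have a0 : a != 0.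
  apply: contraTneq (twgring_mul_neq0 q0 b0) => z.
  by rewrite qb z mulr0 eqxx.
have pb : p * b = p' * a.
  apply: (@ore_emb_inj _ D); rewrite !rmorphM /=.
  have -> : j p = d * j q by rewrite mulrVK ?ore_emb_unit.
  by rewrite -mulrA -rmorphM qb rmorphM e mulrA mulrVK ?ore_emb_unit.
apply/gdiff_eq; exists (newton_poly a + newton_poly b).
have /(congr1 newton_poly) := pb; have /(congr1 newton_poly) := qb.
rewrite !newton_polyM // => e1 e2.
rewrite (AC (2*2) ((1*3)*(2*4))) /= -e2 e1.
by rewrite (AC (2*2) ((1*3)*(4*2))).
Qed.

Lemma newton0 : newton 0 = None.
Proof. by rewrite /newton eqxx. Qed.

Lemma newtonM (x y : D) (X Y : PH) :
  newton x = Some X -> newton y = Some Y -> newton (x * y) = Some (X + Y).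
Proof.
rewrite {1 2}/newton; case: eqVneq => // x0 [<-]; case: eqVneq => // y0 [<-].
rewrite gdiffD {1}(ore_num_den x) {1}(ore_num_den y).
have := ore_num_den x; have := ore_den_neq0 x.
move: (ore_num x) (ore_den x) => p q q0 e.
have p0 : p != 0 by apply: contraNneq x0 => z; rewrite e z rmorph0 mul0r.
have := ore_num_den y; have := ore_den_neq0 y.
move: (ore_num y) (ore_den y) => p' q' q'0 e'.
have p'0 : p' != 0 by apply: contraNneq y0 => z; rewrite e' z rmorph0 mul0r.
have [a [b [b0 [ab qb]]]] := ore_common p' q0.
have a0 : a != 0.
  apply: contraTneq (twgring_mul_neq0 p'0 b0) => z.
  by rewrite qb z mulr0 eqxx.
have -> : j p / j q * (j p' / j q') = j (p * a) / j (q' * b).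
  rewrite !rmorphM /= invrM ?ore_emb_unit // !mulrA -(mulrA (j p)) ab.
  by rewrite !mulrA.
rewrite newton_frac ?twgring_mul_neq0 //; congr Some; apply/gdiff_eq.
exists 0; rewrite !addr0 !newton_polyM //.
have /(congr1 newton_poly) := qb; rewrite !newton_polyM // => e1.
rewrite (AC (2*2) (1*(3*2)*4)) /= -e1.
by rewrite (AC ((1*2)*1) ((1*2)*(4*3))).
Qed.

Lemma newton_some (x : D) : x != 0 -> exists X, newton x = Some X.
Proof. by rewrite /newton => /negbTE ->; eexists. Qed.

Lemma newton_comm (c : D) : comm_sub c -> newton c = Some 0.
Proof.
elim=> [|{}c x y _ IH xu yu].
  have -> : 1 = j 1 / j 1 by rewrite rmorph1 divr1.
  rewrite newton_frac ?oner_neq0 //; congr Some; apply/gdiff_eq.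
  by exists 0; rewrite add0r addr0.
have unz (z : D) : z \is a GRing.unit -> z != 0.
  by apply: contraTneq => ->; rewrite unitr0.
have [X hX] := newton_some (unz _ xu); have [Y hY] := newton_some (unz _ yu).
have xVu : x^-1 \is a GRing.unit by rewrite unitrV.
have yVu : y^-1 \is a GRing.unit by rewrite unitrV.
have [X' hX'] := newton_some (unz _ xVu); have [Y' hY'] := newton_some (unz _ yVu).
have n1 : newton 1 = Some 0.
  have -> : 1 = j 1 / j 1 by rewrite rmorph1 divr1.
  rewrite newton_frac ?oner_neq0 //; congr Some; apply/gdiff_eq.
  by exists 0; rewrite add0r addr0.
have := newtonM hX hX'; rewrite divrr // n1 => -[eX].
have := newtonM hY hY'; rewrite divrr // n1 => -[eY].
have := newtonM IH (newtonM (newtonM (newtonM hX hY) hX') hY').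
by rewrite add0r -addrA addrACA -eX -eY addr0.
Qed.

Lemma newton_abE (d : D) : newton_ab (\pi_(abelianised D) d) = newton d.
Proof.
rewrite /newton_ab; set e := repr _.
have : e == d %[mod abelianised D] by rewrite reprK.
rewrite eqmodE => /asboolP[c hc ->].
have [->|d0] := eqVneq d 0; first by rewrite mulr0.
have [X hX] := newton_some d0.
by rewrite (newtonM (newton_comm hc) hX) add0r hX.
Qed.

End Newton.

Definition single_polytope (R : realType) (n : nat)
    (X : grothendieck (ipolytope R n)) : Prop :=
  exists P Q : ipolytope R n, (exists x, Q = [set x] :> set _) /\ X = gdiff P Q.

(* Main.v *)
Require Import Defs.
From HB Require Import structures.
From mathcomp Require Import all_boot all_order all_algebra all_fingroup finmap.
From mathcomp Require Import monalg.
From mathcomp Require Import all_classical all_reals topology normedtype.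
From mathcomp Require Import ring lra.

Set Implicit Arguments.
Unset Strict Implicit.
Unset Printing Implicit Defensive.

Import Order.TTheory GRing.Theory Num.Theory.

Local Open Scope ring_scope.

(** Write the determinant of [A] as a fraction [p / q]; its Newton polytope is
    [P(p) - P(q)], and the question is whether [P(q)] is a Minkowski summand of
    [P(p)] with an integral complement.

    Algebra.  Fix an additive map [al : H -> Z], a grading of [KH].  Nonzero
    [al]-homogeneous elements form an Ore set, and the fractions with
    [al]-homogeneous denominator form a ring of twisted Laurent polynomials
    over the skew-field of fractions of degree [0]: every nonzero homogeneous
    element is invertible, so the leading term of one element can be divided by
    that of another, and the ring is Euclidean for the width of the set of
    degrees.  Row reduction inside this ring ([dieudonne_euclidean]) shows that
    the Dieudonne determinant of [A] is represented by one of its elements.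
    Hence for every [al] the class [P(p) - P(q)] equals some [P(p') - P(q')]
    where [al] is constant on [P(q')] ([newton_det_homogeneous]).

    Geometry.  The support function of [P(q')] is affine along every line in
    direction [al], and that of [P(p')] is convex.  So the difference [h] of the
    support functions of [P(p)] and [P(q)] is convex along every line with
    integral direction, hence convex.  A convex difference of support functions
    is the support function of a polytope ([hull_difference]): at a functional
    exposing vertices [v] of [P(p)] and [w] of [P(q)] the function [h] is locally
    the linear form [v - w], convexity puts this form below [h] everywhere, and
    so the hull of all such lattice points [v - w] has support function [h]. *)

(** * The Dieudonne determinant under row operations *)

Lemma unit_neq0 (R : unitRingType) (x : R) : x \is a GRing.unit -> x != 0.
Proof. by apply: contraTneq => ->; rewrite unitr0. Qed.

(** Only the image of the determinant under a map [f] that forgets the order of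
    factors and the sign is studied; row permutations then act trivially, and a
    matrix may be treated as an unordered family of rows.  The map will be
    the Newton polytope. *)
Section RowInvariance.
Variables (D : unitRingType) (T : Type) (f : D -> T).
Hypothesis D_skew : GRing.field_axiom D.
Hypothesis fC : forall x y, f (x * y) = f (y * x).
Hypothesis fM : forall x y z, f y = f z -> f (x * y) = f (x * z).
Hypothesis fN : forall x, f (- x) = f x.
Implicit Types (x y z : D).

Lemma fMr x y z : f y = f z -> f (y * x) = f (z * x).
Proof. by move=> e; rewrite fC (fM x e) fC. Qed.

Lemma fMAC x y z : f (x * y * z) = f (y * x * z).
Proof. exact: fMr. Qed.

Lemma f_sign (b : bool) x : f ((-1) ^+ b * x) = f x.
Proof. by case: b; rewrite ?mulN1r ?fN // mul1r. Qed.

(** The matrix on which [dieudonne_rep] recurses after choosing the pivot [i]. *)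
Definition schur (m : nat) (A : 'M[D]_m.+1) (i : 'I_m.+1) : 'M[D]_m :=
  let B : 'M[D]_(1 + m) := xrow i 0 A in
  drsubmx B - dlsubmx B *m (A i 0)^-1%:M *m ursubmx B.

Definition cleared (m : nat) (A : 'M[D]_m.+1) (i k : 'I_m.+1) (l : 'I_m) : D :=
  A k (lift 0 l) - A k 0 * (A i 0)^-1 * A i (lift 0 l).

(** The row of [A] found in row [k] of [schur A i]. *)
Definition other_row (m : nat) (i : 'I_m.+1) (k : 'I_m) : 'I_m.+1 :=
  tperm i 0 (lift 0 k).

Lemma schurE m (A : 'M[D]_m.+1) i k l : schur A i k l = cleared A i (other_row i k) l.
Proof.
rewrite /schur /cleared /other_row -[m.+1]/(1 + m)%N -rshift1.
have z : lshift m (ord0 : 'I_1) = 0 :> 'I_(1 + m) by apply: val_inj.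
by rewrite !mxE big_ord1 !mxE big_ord1 !mxE z eqxx mulr1n tpermR -!rshift1.
Qed.

Lemma other_row_inj m (i : 'I_m.+1) : injective (other_row i).
Proof. by move=> k k' /perm_inj /lift_inj. Qed.

Lemma other_row_neq m (i : 'I_m.+1) k : other_row i k != i.
Proof.
apply/eqP => /(congr1 (tperm i 0)); rewrite tpermK tpermL => /eqP.
by rewrite eq_sym (negbTE (neq_lift _ _)).
Qed.

Lemma other_row_surj m (i k : 'I_m.+1) : k != i -> exists l, other_row i l = k.
Proof.
move=> ki; have : 0 != tperm i 0 k.
  by apply: contra ki => /eqP /(congr1 (tperm i 0)); rewrite tpermK tpermR => ->.
by move=> /unlift_some[l e _]; exists l; rewrite /other_row -e tpermK.
Qed.

Lemma other_row_perm m (i j : 'I_m.+1) (s : 'S_m.+1) :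
  s j = i -> exists u : 'S_m, forall k, s (other_row j k) = other_row i (u k).
Proof.
move=> sj; have h k : exists l, other_row i l = s (other_row j k).
  by apply: other_row_surj; rewrite -sj (inj_eq perm_inj) other_row_neq.
pose u k := projT1 (cid (h k)).
have uE k : other_row i (u k) = s (other_row j k) by rewrite /u; case: cid.
have ui : injective u.
  by move=> k k' /(congr1 (other_row i)); rewrite !uE => /perm_inj /other_row_inj.
by exists (perm ui) => k; rewrite permE uE.
Qed.

(** Scaling the row [r], adding left multiples of it to the other rows and
    permuting the result, in one step: the three operations are kept together
    because a change of pivot is such a combination on the Schur complements. *)
Definition rowmix (m : nat) (A A' : 'M[D]_m) :=
  fun (s : 'S_m) (r : 'I_m) (a : D) (c : 'I_m -> D) =>
  forall k l, A' k l = if s k == r then a * A r l else A (s k) l + c k * A r l.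

Definition rowmix_invariant (m : nat) := forall (A A' : 'M[D]_m) s r a c,
  a != 0 -> rowmix A A' s r a c -> f (dieudonne_rep A') = f (a * dieudonne_rep A).

Lemma rowperm_invariant m (A A' : 'M[D]_m) (s : 'S_m) : rowmix_invariant m ->
  (forall k l, A' k l = A (s k) l) -> f (dieudonne_rep A') = f (dieudonne_rep A).
Proof.
case: m A A' s => [|m] A A' s inv e; first by rewrite [A']flatmx0 [A]flatmx0.
rewrite -[dieudonne_rep A]mul1r.
apply: (inv _ _ s 0 1 (fun=> 0) (oner_neq0 _)) => k l.
by rewrite e mul1r mul0r addr0; case: eqP => [->|].
Qed.

(** The Schur complements for two pivots [i] and [j] differ by a row operation
    with the row that holds the other pivot: clearing row [j] with row [i] gives
    [- A j 0 / A i 0] times the result of clearing row [i] with row [j], and the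
    scalar is exactly what the exchange of the pivots costs. *)
Lemma pivot_invariant m (A : 'M[D]_m.+1) i : rowmix_invariant m -> A i 0 != 0 ->
  f (dieudonne_rep A) = f (A i 0 * dieudonne_rep (schur A i)).
Proof.
move=> inv Ai0 /=; case: pickP => [j Aj0|/(_ i)]; last by rewrite Ai0.
rewrite -mulrA f_sign -/(schur A j).
have [<- //|ij] := eqVneq i j.
have Au : A i 0 \is a GRing.unit by exact: D_skew.
have Bu : A j 0 \is a GRing.unit by exact: D_skew.
have [u uE] := @other_row_perm _ j i (tperm i j) (tpermL _ _).
have [r rE] : exists r, other_row j r = i by exact: other_row_surj.
have mix : rowmix (schur A j) (schur A i) u r (- (A j 0 / A i 0))
    (fun k => - (A (other_row i k) 0 / A i 0)).
  move=> k l; rewrite !schurE -(inj_eq (@other_row_inj _ j)) -uE rE.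
  have [/(canRL (tpermK _ _))|] := eqVneq (tperm i j (other_row i k)) i.
    rewrite tpermL => ->; rewrite /cleared mulrBr !mulNr opprK !mulrA.
    by rewrite mulrVK // divrr // mul1r addrC.
  move=> ni; rewrite tpermD; [|by rewrite eq_sym other_row_neq|]; last first.
    by apply: contra_neq ni => <-; rewrite tpermR.
  rewrite /cleared mulrBr !mulNr opprK !mulrA mulrVK //.
  by rewrite [- _ + _ in RHS]addrC addrA subrK.
rewrite [in RHS](fM _ (inv _ _ _ _ _ _ _ mix)).
  by rewrite mulNr mulrN fN !mulrA; apply: fMr; rewrite fC mulKr.
by apply: unit_neq0; rewrite unitrN unitrMl // unitrV.
Qed.

(** By induction on the size.  If the row [r] has a nonzero first entry, pivoting
    on it in both matrices gives the same Schur complement up to a permutation.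
    Otherwise the first column is unchanged, and with a common pivot the
    operation descends to the Schur complements. *)
Lemma rowmix_invariantP m : rowmix_invariant m.
Proof.
elim: m => [|m inv] A A' s r a c a0 mix; first by case: r {mix} => [[]].
have au := D_skew a0.
have [Ar0|Ar0] := eqVneq (A r 0) 0; last first.
  have Aru := D_skew Ar0.
  have e : A' ((s^-1)%g r) 0 = a * A r 0 by rewrite mix permKV eqxx.
  have e0 : A' ((s^-1)%g r) 0 != 0 by rewrite e unit_neq0 // unitrMl.
  rewrite (pivot_invariant inv e0) e -mulrA.
  rewrite (fM _ (pivot_invariant inv Ar0)); apply/fM/fM.
  have [u uE] := other_row_perm (permKV s r).
  rewrite (rowperm_invariant (s := u) (A := schur A r)) // => k l.
  rewrite !schurE -uE /cleared e !mix permKV eqxx uE (negbTE (other_row_neq _ _)).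
  by rewrite invrM // !mulrDl !mulrA !mulrVK // mulrK // opprD addrACA subrr addr0.
have eA' k : A' k 0 = A (s k) 0.
  by rewrite mix; case: eqP => [->|]; rewrite Ar0 !mulr0 // addr0.
case: (pickP (fun i => A i 0 != 0)) => [i Ai0|Az]; last first.
  rewrite /=; case: pickP => [k|_]; first by rewrite eA' Az.
  by case: pickP => [k|_]; [rewrite Az|rewrite mulr0].
have ir : r != i by apply: contraNneq Ai0 => <-; apply/eqP.
have e : A' ((s^-1)%g i) 0 = A i 0 by rewrite eA' permKV.
have e0 : A' ((s^-1)%g i) 0 != 0 by rewrite e.
rewrite (pivot_invariant inv e0) e (fM _ (pivot_invariant inv Ai0)).
rewrite mulrA fMAC -mulrA; apply: fM.
have [u uE] := other_row_perm (permKV s i).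
have [r' rE] := other_row_surj ir.
apply: (inv _ _ u r' a (fun k => c (other_row ((s^-1)%g i) k) -
   A (s (other_row ((s^-1)%g i) k)) 0 / A i 0 * c ((s^-1)%g i))) => // k l.
rewrite !schurE -(inj_eq (@other_row_inj _ i)) -uE rE /cleared !eA' permKV !mix permKV.
rewrite [i == r]eq_sym (negbTE ir) !Ar0; case: eqP => [->|_].
  by rewrite Ar0 !mul0r !subr0.
by rewrite !mul0r subr0 mulrDr mulrBl !mulrA opprD addrACA.
Qed.

(** The size of an element of the Euclidean ring [E] is given by the relation
    [Ek k x], size at most [k], and not by a function, because a width read off
    from a presentation of [x] is only an upper bound. *)
Section Euclidean.
Variables (E : D -> Prop) (Ek : nat -> D -> Prop).
Hypothesis E0 : E 0.
Hypothesis E1 : E 1.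
Hypothesis EB : forall x y, E x -> E y -> E (x - y).
Hypothesis EM : forall x y, E x -> E y -> E (x * y).
Hypothesis Ek0 : forall x, Ek 0 x -> x = 0.
Hypothesis E_Ek : forall x, E x -> exists k, Ek k x.
Hypothesis Ediv : forall k x y, E x -> Ek k.+1 y -> y != 0 ->
  exists2 q, E q & Ek k (x - q * y).

(** The Euclidean algorithm on the first column: divide by an entry of small
    size until a single entry survives, which then serves as pivot without
    leaving [E]. *)
Lemma dieudonne_euclidean m (A : 'M[D]_m) :
  (forall i j, E (A i j)) -> exists2 e, E e & f (dieudonne_rep A) = f e.
Proof.
elim: m A => [|m IH] A EA; first by exists 1.
case: (pickP (fun i => A i 0 != 0)) => [i Ai0|Az]; last first.
  by exists 0 => //=; case: pickP => [k|//]; rewrite Az.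
have [k Aik] := E_Ek (EA i 0).
elim: k A EA i Ai0 Aik => [|k IHk] A EA i Ai0 Aik.
  by rewrite (Ek0 Aik) eqxx in Ai0.
have h j : exists q, E q /\ Ek k (A j 0 - q * A i 0).
  by have [q ? ?] := Ediv (EA j 0) Aik Ai0; exists q.
pose q j := projT1 (cid (h j)).
have [Eq qk] : (forall j, E (q j)) /\ forall j, Ek k (A j 0 - q j * A i 0).
  by split=> j; rewrite /q; case: cid => ? [].
pose B : 'M[D]_m.+1 := \matrix_(j, l) if j == i then A i l else A j l - q j * A i l.
have EB' j l : E (B j l).
  by rewrite mxE; case: eqP => // _; apply/EB/EM.
have mix : rowmix A B 1%g i 1 (fun j => - q j).
  by move=> j l; rewrite mxE perm1 mul1r mulNr.
have fB : f (dieudonne_rep A) = f (dieudonne_rep B).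
  by rewrite (rowmix_invariantP (oner_neq0 _) mix) mul1r.
rewrite fB; case: (pickP (fun j => (j != i) && (B j 0 != 0))) => [j|Bz].
  move=> /andP[ji Bj0]; apply: (IHk B _ j) => //.
  by rewrite mxE (negbTE ji).
have Bi0 : B i 0 = A i 0 by rewrite mxE eqxx.
have Bi0' : B i 0 != 0 by rewrite Bi0.
rewrite (pivot_invariant (@rowmix_invariantP _) Bi0').
have [j l|e Ee fe] := IH (schur B i).
  rewrite schurE /cleared; have /eqP -> : B (other_row i j) 0 == 0.
    by have := Bz (other_row i j); rewrite other_row_neq => /negbFE.
  by rewrite !mul0r subr0.
exists (B i 0 * e); [exact: EM|exact: fM].
Qed.

End Euclidean.

End RowInvariance.

(** * Fractions with homogeneous denominator *)

Section Homogeneous.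
Variables (H : zmodType) (K : unitRingType) (t : twisting K H).
Local Notation KH := (twgring t).
Variable al : H -> int.
Hypothesis alD : {morph al : x y / x + y}.
Hypothesis KH_domain : forall p q : KH, p != 0 -> q != 0 -> p * q != 0.
Implicit Types (p q : KH) (i k : int) (h : H).

Definition homog i p := forall h, p@_h != 0 -> al h = i.

Definition hcomp i p : KH := \sum_(g <- msupp p | al g == i) << p@_g *g g >>.

Lemma hcomp_coef i p h : (hcomp i p)@_h = if al h == i then p@_h else 0.
Proof.
rewrite /hcomp raddf_sum /=.
have [hp|hp] := boolP (h \in msupp p); last first.
  rewrite (mcoeff_outdom hp) if_same big1_seq // => g /andP[_ gp].
  by rewrite mcoeffU; case: eqP => // e; rewrite -e gp in hp.
rewrite -big_filter; case: ifPn => [hi|hi].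
  rewrite (bigD1_seq h) ?filter_uniq ?fset_uniq ?mem_filter ?hi //=.
  rewrite mcoeffUU big1 ?addr0 // => g gh.
  by rewrite mcoeffU (negbTE gh).
rewrite big1_seq // => g /andP[_]; rewrite mem_filter => /andP[gi _].
by rewrite mcoeffU; case: eqP => // e; rewrite -e gi in hi.
Qed.

Lemma homog0 i : homog i 0.
Proof. by move=> h; rewrite mcoeff0 eqxx. Qed.

Let al0 : al 0 = 0.
Proof. by apply: (addrI (al 0)); rewrite -alD !addr0. Qed.

Lemma homog1 : homog 0 1.
Proof.
move=> h; rewrite mcoeffU; have [<-|_] := eqVneq 0 h; first by rewrite al0.
by rewrite mulr0n eqxx.
Qed.

Lemma homogB i p q : homog i p -> homog i q -> homog i (p - q).
Proof.
move=> hp hq h; rewrite mcoeffB => pq.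
have [z|/hp //] := eqVneq p@_h 0; apply: hq; apply: contraNneq pq => ->.
by rewrite z subrr.
Qed.

Lemma homogM i k p q : homog i p -> homog k q -> homog (i + k) (p * q).
Proof.
move=> hp hq h /twgring_suppM[g [g' [gp gq ->]]].
by rewrite alD (hp g) ?(hq g') // mcoeff_neq0.
Qed.

Lemma homog_hcomp i p : homog i (hcomp i p).
Proof. by move=> h; rewrite hcomp_coef; case: (al h =P i) => // _; rewrite eqxx. Qed.

Lemma hcompM i k p q : homog i p -> hcomp (i + k) (p * q) = p * hcomp k q.
Proof.
move=> hp; rewrite -{1}(subrK (hcomp k q) q) mulrDr.
apply/malgP => h; rewrite hcomp_coef mcoeffD.
case: ifPn => hi; last first.
  have [//|/(homogM hp (@homog_hcomp _ _))] := eqVneq ((p * hcomp k q)@_h) 0.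
  by move/eqP; rewrite (negbTE hi).
rewrite -[RHS]add0r; congr (_ + _); apply/eqP/contraT => /twgring_suppM.
move=> [g [g' [gp gq e]]]; move: gq; rewrite -mcoeff_neq0 mcoeffB hcomp_coef.
case: (al g' =P k) => [_|ng]; first by rewrite subrr eqxx.
move: hi; rewrite e alD (hp g) ?mcoeff_neq0 // => /eqP /addrI.
by move/ng.
Qed.

Variable D : ore_localisation KH.
Local Notation j := (@ore_emb _ D).

Lemma hcomp_neq0 p : p != 0 -> exists i, hcomp i p != 0.
Proof.
move=> p0; have [h _] := msupp_point p0; exists (al (val h)).
apply/eqP => /(congr1 (fun p : KH => p@_(val h))); rewrite hcomp_coef eqxx mcoeff0.
by apply/eqP; rewrite mcoeff_neq0 (valP h).
Qed.

(** The component of some degree of an arbitrary common multiple is a homogeneous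
    common multiple; a degree in which [b] does not vanish has to be chosen. *)
Lemma homog_ore i k p q : homog i p -> homog k q -> q != 0 ->
  exists e a b, [/\ homog (i - k + e) a, homog e b, b != 0 & p * b = q * a].
Proof.
move=> hp hq q0; have [a [b [b0 [_ e]]]] := ore_common D p q0.
have [l bl] := hcomp_neq0 b0.
exists l, (hcomp (i - k + l) a), (hcomp l b); split=> //; try exact: homog_hcomp.
rewrite -(hcompM _ _ hp) e -(hcompM _ _ hq); congr hcomp; ring.
Qed.

(** The elements of degree [i] in the graded ring of homogeneous fractions, [0]
    included. *)
Definition hfrac i (d : D) := exists k p q,
  [/\ homog (i + k) p, homog k q, q != 0 & d = j p / j q].

Lemma ore_frac_expand p q b : q != 0 -> b != 0 -> j p / j q = j (p * b) / j (q * b).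
Proof.
by move=> q0 b0; rewrite !rmorphM invrM ?ore_emb_unit // !mulrA mulrK ?ore_emb_unit.
Qed.

Lemma hfrac0 i : hfrac i 0.
Proof.
exists 0, 0, 1; split; [exact: homog0|exact: homog1|exact: oner_neq0|].
by rewrite rmorph0 mul0r.
Qed.

Lemma homog_common_multiple i k q q' : homog i q -> homog k q' -> q != 0 -> q' != 0 ->
  exists e a b, [/\ homog (i - k + e) a, homog e b, a != 0, b != 0 & q * b = q' * a].
Proof.
move=> hq hq' q0 q'0; have [e [a [b [ha hb b0 ab]]]] := homog_ore hq hq' q'0.
exists e, a, b; split=> //; apply: contraTneq (KH_domain q0 b0) => z.
by rewrite ab z mulr0 eqxx.
Qed.

Lemma hfracB i c d : hfrac i c -> hfrac i d -> hfrac i (c - d).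
Proof.
move=> [k [p [q [hp hq q0 ->]]]] [k' [p' [q' [hp' hq' q'0 ->]]]].
have [e [a [b [ha hb a0 b0 ab]]]] := homog_common_multiple hq hq' q0 q'0.
exists (k + e), (p * b - p' * a), (q * b); split.
- apply: homogB; first by rewrite addrA; exact: homogM.
  have -> : i + (k + e) = i + k' + (k - k' + e) by ring.
  exact: homogM.
- exact: homogM.
- exact: KH_domain.
by rewrite (ore_frac_expand _ q0 b0) (ore_frac_expand _ q'0 a0) -ab rmorphB mulrBl.
Qed.

Lemma hfracM i i' c d : hfrac i c -> hfrac i' d -> hfrac (i + i') (c * d).
Proof.
move=> [k [p [q [hp hq q0 ->]]]] [k' [p' [q' [hp' hq' q'0 ->]]]].
have [e [a [b [ha hb b0 ab]]]] := homog_ore hp' hq q0.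
exists (k' + e), (p * a), (q' * b); split.
- have -> : i + i' + (k' + e) = i + k + (i' + k' - k + e) by ring.
  exact: homogM.
- exact: homogM.
- exact: KH_domain.
rewrite (ore_frac_expand _ q'0 b0) ab !rmorphM mulrA -[_ / _ * (_ * _)]mulrA.
by rewrite mulKr ?ore_emb_unit.
Qed.

Lemma hfracV i d : d != 0 -> hfrac i d -> hfrac (- i) d^-1.
Proof.
move=> d0 [k [p [q [hp hq q0 e]]]].
have p0 : p != 0 by apply: contraNneq d0 => z; rewrite e z rmorph0 mul0r.
exists (i + k), q, p; split=> //; first by rewrite addKr.
by rewrite e invrM ?unitrV ?ore_emb_unit // invrK.
Qed.

(** [window b l] consists of the sums of homogeneous fractions of degrees [b],
    ..., [b + l - 1]. *)
Fixpoint window (b : int) (l : nat) (x : D) : Prop :=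
  if l is l'.+1 then exists y z, [/\ window b l' y, hfrac (b + l'%:Z) z & x = y + z]
  else x = 0.

Lemma windowB b l x y : window b l x -> window b l y -> window b l (x - y).
Proof.
elim: l x y => [|l IH] x y /=; first by move=> -> ->; rewrite subrr.
move=> [x1 [x2 [hx1 hx2 ->]]] [y1 [y2 [hy1 hy2 ->]]].
exists (x1 - y1), (x2 - y2); split; [exact: IH|exact: hfracB|].
by rewrite opprD addrACA.
Qed.

Lemma windowM i c b l x : hfrac i c -> window b l x -> window (i + b) l (c * x).
Proof.
move=> hc; elim: l x => [|l IH] x /=; first by move=> ->; rewrite mulr0.
move=> [y [z [hy hz ->]]]; exists (c * y), (c * z); split; first exact: IH.
  by rewrite -addrA; exact: hfracM.
by rewrite mulrDr.
Qed.

Lemma window_up b l m x : window b l x -> window b (l + m) x.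
Proof.
move=> hx; elim: m => [|m IH]; first by rewrite addn0.
rewrite addnS; exists x, 0; split=> //; [exact: hfrac0|by rewrite addr0].
Qed.

Lemma window_down b l m x : window b l x -> window (b - m%:Z) (l + m) x.
Proof.
move=> hx; elim: m => [|m IH]; first by rewrite subr0 addn0.
have -> : b - m.+1%:Z = b - m%:Z - 1 by rewrite -addn1 PoszD opprD addrA.
rewrite addnS; move: (b - m%:Z) (l + m)%N IH => {hx} c k.
elim: k x => [|k IH] x /=.
  by move=> ->; exists 0, 0; split=> //; [exact: hfrac0|rewrite addr0].
move=> [y [z [hy hz ->]]]; exists y, z; split=> //; first exact: IH.
have -> // : c - 1 + k.+1%:Z = c + k%:Z by rewrite -addn1 PoszD; ring.
Qed.

Lemma window_sub b l b' l' x : b' <= b -> b + l%:Z <= b' + l'%:Z ->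
  window b l x -> window b' l' x.
Proof.
move=> bb le hx; have /(_ `|b - b'|%N) := window_down _ hx.
have e : `|b - b'|%N%:Z = b - b' by rewrite gez0_abs // subr_ge0.
rewrite e subKr => /(window_up (l' - (l + `|b - b'|)))%N.
rewrite subnKC //; rewrite -lez_nat PoszD e; lra.
Qed.

(** The ring of all sums of homogeneous fractions: Laurent polynomials over the
    skew-field [hfrac 0]. *)
Definition laurent (x : D) := exists b l, window b l x.

Definition width_le l (x : D) := exists b, window b l x.

Lemma laurentB x y : laurent x -> laurent y -> laurent (x - y).
Proof.
move=> [b [l hx]] [b' [l' hy]].
pose lo : int := Num.min b b'; pose hi : int := Num.max (b + l%:Z) (b' + l'%:Z).
have [lob lob'] : lo <= b /\ lo <= b' by rewrite !ge_min !lexx orbT.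
have [hil hil'] : b + l%:Z <= hi /\ b' + l'%:Z <= hi.
  by rewrite !le_max !lexx orbT.
have e : lo + `|hi - lo|%N%:Z = hi.
  rewrite gez0_abs; first by ring.
  by have : 0 <= l%:Z by []; rewrite subr_ge0; lra.
exists lo, `|hi - lo|%N; apply: windowB.
  by apply: window_sub hx; rewrite ?e.
by apply: window_sub hy; rewrite ?e.
Qed.

Lemma laurent_hfrac i d : hfrac i d -> laurent d.
Proof.
by move=> hd; exists i, 1, 0, d; split; rewrite ?addr0 ?add0r.
Qed.

Lemma laurent0 : laurent 0.
Proof. exact: laurent_hfrac (hfrac0 0). Qed.

Lemma laurentD x y : laurent x -> laurent y -> laurent (x + y).
Proof.
by move=> hx hy; rewrite -[y]opprK -[- y]add0r; apply/laurentB/laurentB => //; exact: laurent0.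
Qed.

Lemma laurentM x y : laurent x -> laurent y -> laurent (x * y).
Proof.
move=> [b [l hx]] [b' [l' hy]].
elim: l x hx => [|l IH] x /=; first by move=> ->; rewrite mul0r; exact: laurent0.
move=> [x1 [x2 [hx1 hx2 ->]]]; rewrite mulrDl; apply: laurentD; first exact: IH.
by exists (b + l%:Z + b'), l'; exact: windowM.
Qed.

Lemma hfrac_emb i p : homog i p -> hfrac i (j p).
Proof.
move=> hp; exists 0, p, 1; split; rewrite ?addr0 ?oner_neq0 //; first exact: homog1.
by rewrite rmorph1 divr1.
Qed.

Lemma laurent_emb p : laurent (j p).
Proof.
rewrite (tw_expand p) rmorph_sum; apply: big_ind; [exact: laurent0|exact: laurentD|].
move=> g _; apply: (laurent_hfrac (i := al g)); apply: hfrac_emb => h.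
by rewrite mcoeffU; case: (g =P h) => [->|]; rewrite ?mulr0n ?eqxx.
Qed.

Lemma laurent1 : laurent 1.
Proof. by rewrite -(rmorph1 j); exact: laurent_emb. Qed.

(** Common denominators of homogeneous fractions can be taken homogeneous. *)
Lemma laurent_homog_den x : laurent x ->
  exists i p q, [/\ homog i q, q != 0 & x = j p / j q].
Proof.
move=> [b [l]]; elim: l x => [|l IH] x /=.
  move=> ->; exists 0, 0, 1; split; [exact: homog1|exact: oner_neq0|].
  by rewrite rmorph0 mul0r.
move=> [y [z [/IH[i [p [q [hq q0 ->]]]] [k [p' [q' [_ hq' q'0 ->]]]] ->]]].
have [e [a [c [ha hc a0 c0 ac]]]] := homog_common_multiple hq hq' q0 q'0.
exists (i + e), (p * c + p' * a), (q * c); split; [exact: homogM|exact: KH_domain|].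
by rewrite (ore_frac_expand _ q0 c0) (ore_frac_expand _ q'0 a0) -ac rmorphD mulrDl.
Qed.

(** Long division by an element with leading term [z]: as [z] is invertible, the
    leading term [x2] of the dividend is removed by subtracting
    [(x2 / z) * (y + z)]. *)
Lemma window_div b' (k : nat) y z b l x : window b' k y -> hfrac (b' + k%:Z) z -> z != 0 ->
  window b l x -> exists2 q, laurent q & width_le k (x - q * (y + z)).
Proof.
move=> hy hz z0; elim: l x => [|l IH] x hx.
  exists 0; first exact: laurent0.
  rewrite mul0r subr0; exists b; exact: (window_up k hx).
have [lk|kl] := ltnP l k.
  exists 0; first exact: laurent0.
  rewrite mul0r subr0; exists b; rewrite -(subnKC lk); exact: window_up.
move: hx => [x1 [x2 [hx1 hx2 ->]]].
pose c := x2 / z; have hc : hfrac (b + l%:Z - (b' + k%:Z)) c.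
  exact/hfracM/hfracV.
have [|q Eq hq] := IH (x1 - c * y).
  apply: (windowB hx1); apply: window_sub (windowM hc hy); last by lra.
  by move: kl; rewrite -lez_nat; lra.
exists (c + q); first by apply: laurentD => //; exact: laurent_hfrac hc.
have -> // : x1 + x2 - (c + q) * (y + z) = x1 - c * y - q * (y + z).
rewrite mulrDl [c * (y + z)]mulrDr [c * z]mulrVK; last exact: ore_skew.
by rewrite !opprD !addrA [x1 + x2 - _ - _]addrAC addrK.
Qed.

(** The leading term [z] of the divisor in its window may vanish; the divisor is
    then shorter than announced. *)
Lemma width_le_div (k : nat) x y : laurent x -> width_le k.+1 y -> y != 0 ->
  exists2 q, laurent q & width_le k (x - q * y).
Proof.
move=> [b [l hx]]; elim: k y => [|k IHk] y [b' [y' [z [hy' hz ->]]]].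
  have [->|z0] := eqVneq z 0; last by move=> _; apply: (@window_div b' 0 y' z b l x).
  by rewrite hy' addr0 eqxx.
have [->|z0] := eqVneq z 0; last by move=> _; apply: (@window_div b' k.+1 y' z b l x).
rewrite addr0 => /IHk[|q Eq [c hq]]; first by exists b'.
by exists q => //; exists c; rewrite -addn1; exact: window_up.
Qed.

End Homogeneous.

(** * Convex differences of support functions *)

Import numFieldNormedType.Exports.
Local Open Scope classical_set_scope.

Section SupportFunction.
Variables (R : realType) (n : nat).
Local Notation V := 'rV[R]_n.
Implicit Types (a : 'cV[R]_n) (x : V) (P Q : set V).

Definition suppfun a P : R := sup (pairing a @` P).

Lemma continuous_pairing a : continuous (pairing a : V -> R).
Proof.
have -> : (pairing a : V -> R) = (fun y => \sum_j y 0 j * a j 0).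
  by apply/funext => y; rewrite pairingE.
move=> x; apply: (continuous_big add_continuous) => j _ y.
by apply: continuousM; [exact: coord_continuous|exact: cst_continuous].
Qed.

Lemma has_sup_pairing a P : P !=set0 -> compact P -> has_sup (pairing a @` P).
Proof.
move=> [x Px] cP; apply: compact_has_sup; first by exists (pairing a x), x.
apply: continuous_compact cP; apply: continuous_subspaceT.
exact: continuous_pairing.
Qed.

Lemma suppfun_minkowski a P Q : P !=set0 -> compact P -> Q !=set0 -> compact Q ->
  suppfun a (minkowski_sum P Q) = suppfun a P + suppfun a Q.
Proof.
move=> P0 cP Q0 cQ; rewrite /suppfun -sup_sumE; [|exact: has_sup_pairing..].
congr sup; apply/seteqP; split.
  move=> _ [_ [x Px [y Qy <-]] <-]; exists (pairing a x); first by exists x.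
  by exists (pairing a y); [exists y|rewrite pairingDr].
move=> _ [_ [x Px <-] [_ [y Qy <-] <-]].
by exists (x + y); [exists x => //; exists y|rewrite pairingDr].
Qed.

Section Hull.
Variables (J : finType) (v : J -> V).

Lemma hull_pairing_le a (b : R) : (forall k, pairing a (v k) <= b) ->
  forall x, convex_hull (range v) x -> pairing a x <= b.
Proof.
move=> h x; apply: (@hull_min _ _ _ (halfspace a b)); first exact: convex_halfspace.
by move=> _ [k _ <-]; exact: h.
Qed.

Lemma suppfun_eq a j : (forall k, pairing a (v k) <= pairing a (v j)) ->
  suppfun a (convex_hull (range v)) = pairing a (v j).
Proof.
move=> h; have hj : convex_hull (range v) (v j) by apply: sub_hull; exists j.
apply/le_anti/andP; split.
  apply: ge_sup; first by exists (pairing a (v j)), (v j).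
  by move=> _ [x hx <-]; exact: hull_pairing_le hx.
apply: ub_le_sup; last by exists (v j).
exists (pairing a (v j)) => _ [x hx <-]; exact: hull_pairing_le hx.
Qed.

Lemma suppfun_attained (j0 : J) a : exists j,
  suppfun a (convex_hull (range v)) = pairing a (v j) /\
  forall k, pairing a (v k) <= pairing a (v j).
Proof.
pose j := [arg max_(p > j0) pairing a (v p)]%O.
have h k : pairing a (v k) <= pairing a (v j).
  by rewrite /j; case: Order.TotalTheory.arg_maxP => // q _ /(_ k isT).
by exists j; split=> //; exact: suppfun_eq.
Qed.

End Hull.

(** A common step size for finitely many strict inequalities. *)
Lemma small_step (I : finType) (a b : I -> R) :
  exists s, [/\ 0 < s, s <= 1 & forall i, a i != 0 -> `|s * b i| < `|a i|].
Proof.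
pose S := 1 + \sum_i `|b i| / `|a i|.
have S0 : 0 <= \sum_i `|b i| / `|a i| by apply: sumr_ge0 => i _; rewrite divr_ge0.
have S1 : 0 < S by rewrite /S; lra.
exists S^-1; split; [by rewrite invr_gt0|rewrite invf_le1 // /S; lra|].
move=> i ai; rewrite normrM ger0_norm ?invr_ge0 ?ltW // mulrC ltr_pdivrMr //.
rewrite mulrC -ltr_pdivrMr ?normr_gt0 // /S (bigD1 i) //=.
have : 0 <= \sum_(k | k != i) `|b k| / `|a k|.
  by apply: sumr_ge0 => k _; rewrite divr_ge0.
lra.
Qed.

Lemma pairing_tr x : x != 0 -> pairing x^T x != 0.
Proof.
apply: contra_neq => /eqP; rewrite pairingE psumr_eq0 => [/allP h|i _]; last first.
  by rewrite mxE -expr2 sqr_ge0.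
apply/rowP => i; have := h i; rewrite mem_index_enum !mxE => /(_ isT).
by rewrite mulf_eq0 orbb => /eqP.
Qed.

(** A small perturbation of [a] in direction [b] keeps the positive and the
    nonzero values of [a] and gains the nonvanishing of [b] where [a] vanishes. *)
Lemma generic_step (I : finType) (d : I -> V) a b : exists a',
  forall i, (0 < pairing a (d i) -> 0 < pairing a' (d i)) /\
            (pairing a (d i) != 0 -> pairing a' (d i) != 0) /\
            (pairing a (d i) = 0 -> pairing b (d i) != 0 -> pairing a' (d i) != 0).
Proof.
have [s [s0 _ h]] := small_step (fun i => pairing a (d i)) (fun i => pairing b (d i)).
exists (a + s *: b) => i; rewrite pairingDl pairingZl.
have := h i; move: (pairing a (d i)) (pairing b (d i)) => x y {}h.
split=> [x0|].
  have := h; rewrite (gt_eqF x0) (gtr0_norm x0) => /(_ isT).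
  by rewrite ltr_norml => /andP[? _]; lra.
split=> [x0|-> y0]; last first.
  by rewrite add0r mulf_neq0 // lt0r_neq0.
apply: contraTneq (h x0) => /eqP; rewrite addrC addr_eq0 => /eqP ->.
by rewrite normrN ltxx.
Qed.

(** Off the finitely many hyperplanes orthogonal to the [d i], found by
    perturbing once for each [i] in the direction [(d i)^T], whose value at
    [d i] is positive unless [d i] vanishes. *)
Lemma generic_functional (I : finType) (d : I -> V) a : exists a',
  forall i, (0 < pairing a (d i) -> 0 < pairing a' (d i)) /\
            (d i != 0 -> pairing a' (d i) != 0).
Proof.
suff h (s : seq I) : exists a', forall i, (0 < pairing a (d i) -> 0 < pairing a' (d i)) /\
   (i \in s -> d i != 0 -> pairing a' (d i) != 0).
  have [a' ha'] := h (index_enum I); exists a' => i.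
  by have [? h2] := ha' i; split=> //; apply: h2; rewrite mem_index_enum.
elim: s => [|k s [a' IH]]; first by exists a.
have [a'' h] := generic_step d a' (d k)^T; exists a'' => i.
have [h1 h2] := IH i; have [h3 [h4 h5]] := h i.
split=> [/h1/h3 //|]; rewrite inE => /orP[/eqP-> di|is_ di]; last exact/h4/h2.
have [h3' [h4' h5']] := h k.
have [z|/h4' //] := eqVneq (pairing a' (d k)) 0.
by apply: h5' => //; exact: pairing_tr.
Qed.

Section Difference.
Variables (J L : finType) (v : J -> V) (w : L -> V) (j0 : J) (l0 : L).
Let P := convex_hull (range v).
Let Q := convex_hull (range w).

Definition suppdiff a : R := suppfun a P - suppfun a Q.

(** Indices of equal points are not distinguished, so that [u] may be any family. *)
Definition exposed (I : finType) (u : I -> V) a i :=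
  forall k, u k != u i -> pairing a (u k) < pairing a (u i).

Lemma exposed_suppfun (I : finType) (u : I -> V) a i : exposed u a i ->
  suppfun a (convex_hull (range u)) = pairing a (u i).
Proof.
by move=> h; apply: suppfun_eq => k; have [->|/h/ltW] := eqVneq (u k) (u i).
Qed.

(** The faces of [P] and [Q] on which [a] is maximal contain vertices that are
    exposed by one functional near [a]. *)
Lemma exposed_exists a : exists a' j l,
  [/\ exposed v a' j, exposed w a' l, suppfun a P = pairing a (v j) &
      suppfun a Q = pairing a (w l)].
Proof.
pose d (i : (J * J) + (L * L)) :=
  match i with inl (j, k) => v j - v k | inr (j, k) => w j - w k end.
have [a' ha'] := generic_functional d a.
have main (I : finType) (u : I -> V) (i0 : I) :
    (forall i k, (0 < pairing a (u i - u k) -> 0 < pairing a' (u i - u k)) /\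
            (u i - u k != 0 -> pairing a' (u i - u k) != 0)) ->
    exists i, exposed u a' i /\ suppfun a (convex_hull (range u)) = pairing a (u i).
  move=> h; have [i [_ hi]] := suppfun_attained u i0 a'.
  exists i; split=> [k uk|].
    rewrite lt_neqAle hi andbT -subr_eq0 -pairingBr.
    by apply: (h k i).2; rewrite subr_eq0.
  apply: suppfun_eq => k; rewrite leNgt -subr_gt0 -pairingBr; apply/negP => /(h k i).1.
  by rewrite pairingBr subr_gt0 ltNge hi.
have [j [ej sj]] := main _ v j0 (fun i k => ha' (inl (i, k))).
have [l [el sl]] := main _ w l0 (fun i k => ha' (inr (i, k))).
by exists a', j, l.
Qed.

(** Convexity is only required in integral directions, the ones that the gradings
    of the group ring provide. *)
Hypothesis suppdiff_convex : forall a (c : 'cV[int]_n) (r s : R), 0 < s -> s <= 1 ->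
  suppdiff (a + s *: (r *: map_mx intr c)) <=
  (1 - s) * suppdiff a + s * suppdiff (a + r *: map_mx intr c).

(** Near [a] the function [suppdiff] is the linear form [v j - w l]; by convexity
    on the segment to [a + r c], its value at the far end is at least that of the
    linear form. *)
Lemma suppdiff_ge_integral a j l (c : 'cV[int]_n) (r : R) : exposed v a j -> exposed w a l ->
  pairing (a + r *: map_mx intr c) (v j - w l) <= suppdiff (a + r *: map_mx intr c).
Proof.
move=> ej el; pose b : 'cV[R]_n := r *: map_mx intr c.
pose d (i : J + L) := match i with inl k => v j - v k | inr k => w l - w k end.
have [s [s0 s1 hs]] := small_step (fun i => pairing a (d i)) (fun i => pairing b (d i)).
have main (I : finType) (u : I -> V) i : exposed u a i ->
    (forall k, pairing a (u i - u k) != 0 ->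
       `|s * pairing b (u i - u k)| < `|pairing a (u i - u k)|) ->
    suppfun (a + s *: b) (convex_hull (range u)) = pairing (a + s *: b) (u i).
  move=> e h; apply: suppfun_eq => k; rewrite -subr_ge0 -pairingBr.
  have [->|/e] := eqVneq (u k) (u i); first by rewrite subrr /pairing mul0mx mxE.
  rewrite -subr_gt0 -pairingBr => p0; have := h k; rewrite gt_eqF // => /(_ isT).
  rewrite (gtr0_norm p0) ltr_norml pairingDl (pairingZl b s) => /andP[? _]; lra.
have := suppdiff_convex a c r s0 s1; rewrite -/b {1 2}/suppdiff.
rewrite (main _ v j ej (fun k => hs (inl k))) (main _ w l el (fun k => hs (inr k))).
rewrite (exposed_suppfun ej) (exposed_suppfun el) -!pairingBr !pairingDl (pairingZl b s) => h.
have : s * (pairing a (v j - w l) + pairing b (v j - w l)) <= s * suppdiff (a + b) by lra.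
by rewrite ler_pM2l.
Qed.

(** The functionals [a' + r c] with [c] integral are dense, and both sides are
    Lipschitz in the functional. *)
Lemma suppdiff_ge a a' j l : exposed v a' j -> exposed w a' l ->
  pairing a (v j - w l) <= suppdiff a.
Proof.
move=> ej el; rewrite leNgt; apply/negP => lt.
pose B (I : finType) (u : I -> V) := \sum_k \sum_i `|u k 0 i|.
have B0 (I : finType) (u : I -> V) : 0 <= B I u.
  by apply: sumr_ge0 => k _; apply: sumr_ge0 => i _.
pose C := B J v + B L w.
pose e := pairing a (v j - w l) - suppdiff a.
have e0 : 0 < e by rewrite subr_gt0.
have C0 : 0 <= C by rewrite addr_ge0.
(* The functional [a] is approximated with mesh [1 / N].  Four pairings enter
   below, two with points [v] and two with points [w]; they move by at most
   [B J v / N] and [B L w / N] each, hence by less than [e] in total. *)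
have [N CN] : exists N, 2 * C / e < N by exists (2 * C / e + 1); rewrite ltrDl.
have N0 : 0 < N by apply: le_lt_trans CN; rewrite divr_ge0 ?mulr_ge0 // ltW.
pose c : 'cV[int]_n := \col_i Num.floor (N * (a i 0 - a' i 0)).
pose b : 'cV[R]_n := a' + N^-1 *: map_mx intr c.
have ab i : `|a i 0 - b i 0| <= N^-1.
  have /andP[h1 h2] := floor_itv (N * (a i 0 - a' i 0)).
  have -> : a i 0 - b i 0 = N^-1 * (N * (a i 0 - a' i 0) - (c i 0)%:~R).
    by rewrite !mxE; field; rewrite gt_eqF.
  rewrite normrM gtr0_norm ?invr_gt0 // ler_piMr ?invr_ge0 ?(ltW N0) //.
  move: h1 h2; rewrite mxE ler_norml intrD mulr1z; lra.
have near (I : finType) (u : I -> V) k :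
    `|pairing a (u k) - pairing b (u k)| <= B I u / N.
  rewrite -[pairing a _ - _]/(_ + - _) -pairingNl -pairingDl pairingE.
  apply: le_trans (ler_norm_sum _ _ _) _.
  apply: le_trans (_ : \sum_i `|u k 0 i| / N <= _).
    apply: ler_sum => i _; rewrite normrM ler_wpM2l // !mxE.
    by have := ab i; rewrite !mxE.
  rewrite -mulr_suml ler_wpM2r ?invr_ge0 ?(ltW N0) // /B (bigD1 k) //= lerDl.
  by apply: sumr_ge0 => m _; apply: sumr_ge0.
have [j1 [e1 _]] := suppfun_attained v j0 b; have [l1 [e2 m2]] := suppfun_attained w l0 a.
have [j2 [e3 m3]] := suppfun_attained v j0 a; have [l2 [e4 m4]] := suppfun_attained w l0 b.
have ge_b := suppdiff_ge_integral c N^-1 ej el.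
rewrite -/b /suppdiff [suppfun b P]e1 [suppfun b Q]e4 pairingBr in ge_b.
have eE : e = pairing a (v j) - pairing a (w l) - (pairing a (v j2) - pairing a (w l1)).
  by rewrite /e /suppdiff [suppfun a P]e3 [suppfun a Q]e2 pairingBr.
have lt_e : 2 * (B J v / N) + 2 * (B L w / N) < e.
  move: CN; rewrite ltr_pdivrMr // -ltr_pdivrMl // /C.
  by congr (_ < _); field; rewrite gt_eqF.
have /ler_normlP [n1 n2] := near _ v j; have /ler_normlP [n3 n4] := near _ w l.
have /ler_normlP [n5 n6] := near _ v j1; have /ler_normlP [n7 n8] := near _ w l1.
have h1 := m3 j1; have h2 := m4 l1.
lra.
Qed.

(** The complement of [Q] in [P] is the hull of the differences of simultaneously
    exposed vertices: by [suppdiff_ge] its support function is at most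
    [suppdiff], and by [exposed_exists] it is at least that.  A hull of finitely
    many points is cut out by halfspaces, so it is enough to compare support
    functions. *)
Lemma hull_difference : (forall j, lattice (v j)) -> (forall l, lattice (w l)) ->
  exists S : ipolytope R n, P = minkowski_sum S Q.
Proof.
move=> vL wL.
pose good (i : J * L) := `[< exists a, exposed v a i.1 /\ exposed w a i.2 >].
pose u (i : {i | good i}) := v (val i).1 - w (val i).2.
have gu j l a : exposed v a j -> exposed w a l -> exists i, u i = v j - w l.
  move=> ej el; have g : good (j, l) by apply/asboolP; exists a.
  by exists (exist _ (j, l) g).
have [a0 [j1 [l1 [/gu h1 /h1[i0 _] _ _]]]] := exposed_exists 0.
have uL i : lattice (u i).
  have [z _ ez] := vL (val i).1; have [z' _ ez'] := wL (val i).2.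
  by exists (z - z') => //; rewrite /u -ez -ez' map_mxB.
pose S := IPolytope (polytope_hull u i0)
  (hull_nonempty (ex_intro _ (u i0) (ex_intro2 _ _ i0 Logic.I erefl))) (integral_hull uL).
exists S; rewrite [ipoly S]/=; apply/seteqP; split=> [x Px|_ [y Sy [z Qz <-]]].
  have [I [a [b hP]]] := polyhedral_minkowski (polyhedral_hull u) (polyhedral_hull w).
  apply/hP => i; have [a' [j [l [ej el sj sl]]]] := exposed_exists (a i).
  have [k uk] := gu _ _ _ ej el.
  have [m [sm vm]] := suppfun_attained v j0 (a i).
  have := hull_pairing_le vm Px; rewrite -sm sj => /le_trans; apply.
  rewrite -[v j](subrK (w l)) -uk; apply: (hP _).1.
  exists (u k); first by apply: sub_hull; exists k.
  by exists (w l) => //; apply: sub_hull; exists l.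
have [I [a [b hP]]] := polyhedral_hull v; apply/hP => i.
have [j [sj vj]] := suppfun_attained v j0 (a i); have [l [sl wl]] := suppfun_attained w l0 (a i).
have /hP/(_ i) : P (v j) by apply: sub_hull; exists j.
apply: le_trans; rewrite -sj pairingDr -[leRHS](subrK (suppfun (a i) Q)) lerD //.
  apply: (hull_pairing_le _ Sy) => k; have /asboolP[a' [ek em]] := valP k.
  exact: suppdiff_ge ek em.
by rewrite sl; exact: hull_pairing_le Qz.
Qed.

End Difference.
End SupportFunction.

(** * The Newton polytope of a determinant *)

Section Main.
Variables (R : realType) (H : zmodType) (n : nat) (iota : {additive H -> 'rV[int]_n}).
Hypothesis iota_inj : injective iota.
Variables (K : unitRingType) (t : twisting K H).
Hypothesis K_skew : GRing.field_axiom K.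
Variable D : ore_localisation (twgring t).
Local Notation KH := (twgring t).
Local Notation j := (@ore_emb _ D).
Local Notation nt := (@newton R n H iota K t D).

Let iotaD : {morph iota : x y / x + y} := raddfD iota.

Lemma newton_mulC (x y : D) : nt (x * y) = nt (y * x).
Proof.
have [->|x0] := eqVneq x 0; first by rewrite mul0r mulr0.
have [->|y0] := eqVneq y 0; first by rewrite mul0r mulr0.
have [X eX] := newton_some R iota x0; have [Y eY] := newton_some R iota y0.
rewrite (newtonM K_skew iota_inj iotaD eX eY).
rewrite (newtonM K_skew iota_inj iotaD eY eX).
by rewrite addrC.
Qed.

Lemma newton_mull (x y z : D) : nt y = nt z -> nt (x * y) = nt (x * z).
Proof.
have [->|x0] := eqVneq x 0; first by rewrite !mul0r.
have [X eX] := newton_some R iota x0.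
have [->|y0] := eqVneq y 0.
  have [->//|z0] := eqVneq z 0.
  by have [Z ->] := newton_some R iota z0; rewrite newton0.
have [Y eY] := newton_some R iota y0; rewrite eY => /esym eZ.
rewrite (newtonM K_skew iota_inj iotaD eX eY).
by rewrite (newtonM K_skew iota_inj iotaD eX eZ).
Qed.

Lemma newton_polyN (p : KH) : newton_poly R iota (- p) = newton_poly R iota p.
Proof.
have [->|p0] := eqVneq p 0; first by rewrite oppr0.
apply: ipolytope_inj; rewrite !newton_polyE ?oppr_eq0 // /newton_set.
congr convex_hull; apply/seteqP; split=> _ [h /= ph <-]; exists h => //=; move: ph;
  by rewrite mcoeffN oppr_eq0.
Qed.

Lemma newtonN (x : D) : nt (- x) = nt x.
Proof.
have [->|x0] := eqVneq x 0; first by rewrite oppr0.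
have q0 := ore_den_neq0 x; have e := ore_num_den x.
have p0 : ore_num x != 0 by apply: contraNneq x0 => z; rewrite e z rmorph0 mul0r.
rewrite e -mulNr -rmorphN !newton_frac ?oppr_eq0 //.
by rewrite newton_polyN.
Qed.

(** The entries of [A] are Laurent polynomials for the grading [al], so is its
    determinant by [dieudonne_euclidean], and a Laurent polynomial is a fraction
    with homogeneous denominator. *)
Lemma newton_det_homogeneous (al : H -> int) (m : nat) (A : 'M[KH]_m) :
  {morph al : x y / x + y} ->
  exists i (p q : KH), [/\ homog al i q, q != 0 &
    nt (dieudonne_rep (map_mx j A)) = nt (j p / j q)].
Proof.
move=> alD; have dom p q : p != 0 -> q != 0 -> p * q != 0 :> KH.
  exact: twgring_mul_neq0 K_skew iota_inj iotaD _ _.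
have [||||||||e Ee ->] := @dieudonne_euclidean D _ nt (@ore_skew _ D)
  newton_mulC newton_mull newtonN
  (@laurent _ _ _ al D) (@width_le _ _ _ al D) _ _ _ _ _ _ _ m (map_mx j A).
- exact: laurent0.
- exact: laurent1.
- exact: laurentB.
- exact: laurentM.
- by move=> x [b].
- by move=> x [b [l hx]]; exists l, b.
- exact: width_le_div.
- by move=> i k; rewrite mxE; exact: laurent_emb.
have [i [p [q [hq q0 ->]]]] := laurent_homog_den alD dom Ee.
by exists i, p, q.
Qed.

Definition functional (c : 'cV[int]_n) (h : H) : int := (iota h *m c) 0 0.

Lemma functionalD c : {morph functional c : x y / x + y}.
Proof. by move=> x y; rewrite /functional iotaD mulmxDl mxE. Qed.

Lemma pairing_functional c h :
  pairing (map_mx intr c) (lattice_emb R iota h) = (functional c h)%:~R.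
Proof. by rewrite /pairing /lattice_emb -map_mxM mxE. Qed.

Lemma suppfun_add a (P Q : ipolytope R n) :
  suppfun a (P + Q : ipolytope R n) = suppfun a P + suppfun a Q.
Proof.
by apply: suppfun_minkowski; [exact: ipoly_nonempty|case: (ipoly_poly P)|
  exact: ipoly_nonempty|case: (ipoly_poly Q)].
Qed.

Lemma suppfun_gdiff a (P Q P' Q' : ipolytope R n) : gdiff P Q = gdiff P' Q' ->
  suppfun a P - suppfun a Q = suppfun a P' - suppfun a Q'.
Proof.
move=> /gdiff_eq[e] /(congr1 (fun P : ipolytope R n => suppfun a P)).
rewrite !suppfun_add; lra.
Qed.

Lemma suppfun_convex (p : KH) a b (s : R) : p != 0 -> 0 <= s -> s <= 1 ->
  suppfun (a + s *: b) (newton_set iota p) <=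
  (1 - s) * suppfun a (newton_set iota p) + s * suppfun (a + b) (newton_set iota p).
Proof.
move=> /msupp_point[h0 _] s0 s1; rewrite newton_setE; set v := fun h => _.
have [h [-> _]] := suppfun_attained v h0 (a + s *: b).
have [h1 [-> m1]] := suppfun_attained v h0 a.
have [h2 [-> m2]] := suppfun_attained v h0 (a + b).
have := m1 h; have := m2 h; rewrite !pairingDl pairingZl; nra.
Qed.

(** The Newton polytope of a homogeneous element lies in a hyperplane on which
    [c] is constant. *)
Lemma suppfun_homogeneous (q : KH) i c a (r : R) : q != 0 -> homog (functional c) i q ->
  suppfun (a + r *: map_mx intr c) (newton_set iota q) =
  suppfun a (newton_set iota q) + r * i%:~R.
Proof.
move=> /msupp_point[h0 _] hq; rewrite newton_setE; set v := fun h => _.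
have vi h : pairing (map_mx intr c) (v h) = i%:~R.
  by rewrite /v pairing_functional (hq (val h)) // mcoeff_neq0 (valP h).
have [h [-> m1]] := suppfun_attained v h0 a.
rewrite (@suppfun_eq _ _ _ _ _ h) => [|k].
  by rewrite pairingDl pairingZl vi.
by rewrite !pairingDl !pairingZl !vi lerD2r m1.
Qed.

Lemma newton_det_single (m : nat) (A : 'M[KH]_m) X :
  nt (dieudonne_rep (map_mx j A)) = Some X -> single_polytope X.
Proof.
set d := dieudonne_rep _ => eX.
have d0 : d != 0 by apply: contra_eq_neq eX => ->; rewrite newton0.
have q0 := ore_den_neq0 d; have e := ore_num_den d.
have p0 : ore_num d != 0 by apply: contraNneq d0 => z; rewrite e z rmorph0 mul0r.
move: eX; rewrite e newton_frac // => -[<-].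
move: (ore_num d) (ore_den d) e q0 p0 => p q e q0 p0.
have [h0 _] := msupp_point p0; have [l0 _] := msupp_point q0.
have latt (h : H) : lattice (lattice_emb R iota h) by exists (iota h).
have [|S] := @hull_difference _ _ _ _ (fun h : msupp p => lattice_emb R iota (val h))
  (fun h : msupp q => lattice_emb R iota (val h)) h0 l0 _ (fun=> latt _) (fun=> latt _).
  move=> a c r s s0 s1; rewrite /suppdiff -!newton_setE.
  have [i [p' [q' [hq' q'0 ed]]]] := newton_det_homogeneous A (@functionalD c).
  rewrite -/d e newton_frac // in ed.
  have p'0 : p' != 0.
    by apply: contra_eq_neq ed => ->; rewrite rmorph0 mul0r newton0.
  move: ed; rewrite newton_frac // => -[/suppfun_gdiff ed].
  have {}ed b := ed b; move: ed; rewrite !newton_polyE // => ed; rewrite !ed.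
  rewrite scalerA !(suppfun_homogeneous _ _ q'0 hq').
  have := suppfun_convex a (r *: map_mx intr c) p'0 (ltW s0) s1.
  rewrite scalerA; nra.
rewrite -!newton_setE => pS.
exists S, 0; split; first by exists 0.
apply/gdiff_eq; exists 0; rewrite !addr0; apply: ipolytope_inj.
by rewrite newton_polyE // pS -(newton_polyE R iota q0).
Qed.

End Main.

Theorem theorem3p14 (R : realType)
    (H : zmodType) (n : nat) (iota : {additive H -> 'rV[int]_n})
    (iota_bij : bijective iota)
    (K : unitRingType) (K_skew : GRing.field_axiom K) (t : twisting K H)
    (D : ore_localisation (twgring t)) (m : nat) (A : 'M[twgring t]_m) :
  newton_mx R iota D A = None \/
  exists2 X, newton_mx R iota D A = Some X & single_polytope X.
Proof.
have iota_inj := bij_inj iota_bij.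
rewrite /newton_mx /dieudonne newton_abE //; last exact: raddfD.
case e : (newton _ _ _) => [X|]; [right|by left].
by exists X => //; exact: newton_det_single e.
Qed.
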